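(* Let $n\ge1$ and let $\Pi\subseteq\mathfrak{S}_n$. Suppose that the quasisymmetric generating function $Q(\Pi)$ is a symmetric function with power sum expansion $Q(\Pi)=q(p_1,p_2,p_3,\dots)=\sum_{\lambda\vdash n}c_\lambda p_\lambda$. Then \begin{align*} \frac{(1+t^2)^n}{2(1-t)^2(1-t^2)^{n-1}}P^{\mathrm{udr}}\left(\Pi;\frac{2t}{1+t^2}\right) &=\sum_{k=0}^\infty\Theta_{1,k}(Q(\Pi))\,t^{2k}+\sum_{k=0}^\infty\Theta_{1,k}(Q(\Pi)[X+1])\,t^{2k+1}\\ &=\sum_{\substack{\lambda\vdash n\\ \text{odd}}}c_\lambda2^{l(\lambda)}\frac{A_{l(\lambda)}(t^2)}{(1-t^2)^{l(\lambda)+1}}+t\sum_{\lambda\vdash n}c_\lambda\frac{B_{o(\lambda)}(t^2)}{(1-t^2)^{o(\lambda)+1}}\\ &=\sum_{k=1}^na_k2^k\frac{A_k(t^2)}{(1-t^2)^{k+1}}+t\sum_{k=0}^nd_k\frac{B_k(t^2)}{(1-t^2)^{k+1}}, \end{align*} where $\sum_{k=1}^na_kw^k=q(w,0,w,0,w,0,\dots)$, $\sum_{k=0}^nd_kw^k=q(w,1,w,1,w,1,\dots)$, and the sum marked ''odd'' is over partitions of $n$ all of whose parts are odd.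
   Context: $\mathfrak{S}_n$ is the set of permutations $\pi=\pi(1)\cdots\pi(n)$ of $[n]=\{1,\dots,n\}$. An index $i\in[n-1]$ is a descent of $\pi$ if $\pi(i)>\pi(i+1)$; $\mathrm{des}(\pi)$ is the number of descents. A birun of $\pi$ is a maximal monotone consecutive subsequence of $\pi$; an up-down run of $\pi$ is a birun of $\pi$, or the single letter $\pi(1)$ if $\pi(1)>\pi(2)$. $\mathrm{udr}(\pi)$ is the number of up-down runs (equal to $1$ for the permutation of length $1$); e.g. $71462853$ has up-down runs $7,71,146,62,28,853$. Put $P^{\mathrm{udr}}(\Pi;t)=\sum_{\pi\in\Pi}t^{\mathrm{udr}(\pi)}$. Eulerian polynomials: $A_n(t)=\sum_{\pi\in\mathfrak{S}_n}t^{\mathrm{des}(\pi)+1}$ for $n\ge1$, $A_0(t)=1$. Type B Eulerian polynomials: $\frac{B_n(t)}{(1-t)^{n+1}}=\sum_{k=0}^\infty(2k+1)^nt^k$ for $n\ge0$. Quasisymmetric generating function: $Q(\Pi)=\sum_{\pi\in\Pi}F_\pi$, where, for $\pi\in\mathfrak{S}_n$, $F_\pi=\sum x_{i_1}x_{i_2}\cdots x_{i_n}$, the sum being over all positive integers $i_1\le\cdots\le i_n$ with $i_j<i_{j+1}$ whenever $j$ is a descent of $\pi$. $\Lambda$ is the $\mathbb{Q}$-algebra of symmetric functions in $x_1,x_2,\dots$; $p_i=\sum_jx_j^i$ and $p_\lambda=p_{\lambda_1}p_{\lambda_2}\cdots$ are the power sums; $q$ denotes the polynomial expressing $Q(\Pi)$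 in $p_1,p_2,\dots$; $l(\lambda)$ is the number of parts and $o(\lambda)$ the number of odd parts of a partition $\lambda$. Plethysm: for $a$ in a $\mathbb{Q}$-algebra of formal power series, $f\mapsto f[a]$ is the $\mathbb{Q}$-algebra homomorphism on $\Lambda$ such that $p_i[a]$ is obtained from $a$ by replacing every variable by its $i$th power. With $X=x_1+x_2+\cdots=p_1$, the map $f\mapsto f[X+1]$ is thus the homomorphism with $p_i\mapsto p_i+1$. For $k\in\mathbb{Z}$, $\Theta_{1,k}(f)=f[k(1-\alpha)]\big|_{\alpha=-1}$, where $\alpha$ is a variable; that is, $\Theta_{1,k}$ is the $\mathbb{Q}$-algebra homomorphism on $\Lambda$ with $\Theta_{1,k}(p_i)=k(1-(-1)^i)$. Rational functions of $t$ are expanded as formal power series in $t$. *)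

(* Defs.v *)
From HB Require Import structures.
From mathcomp Require Import all_boot all_order all_algebra all_fingroup.
From mathcomp Require Import boolp finmap multiset ring.

Set Implicit Arguments.
Unset Strict Implicit.
Unset Printing Implicit Defensive.

Import Order.TTheory GRing.Theory Num.Theory.
Local Open Scope mset_scope.
Local Open Scope ring_scope.

(** Formal power series over [rat]

   A series is the family of its coefficients, indexed by a commutative monoid
   [M] of exponents (written additively) in which every element has finitely
   many decompositions as a sum of two.  [M = nat] gives Q[[t]] and
   [M = {mset nat}] gives Q[[x_1, x_2, ...]]. *)

HB.mixin Record hasDecompositions M of GRing.Nmodule M := {
  decomp : M -> seq (M * M);
  decomp_uniq : forall m, uniq (decomp m);
  mem_decomp : forall m p, (p \in decomp m) = (p.1 + p.2 == m)
}.

#[short(type="expMonoidType")]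
HB.structure Definition ExpMonoid :=
  { M of GRing.Nmodule M & hasDecompositions M }.

Definition series (M : expMonoidType) : Type := M -> rat.

Section SeriesRing.
Variable M : expMonoidType.
Implicit Types f g h : series M.

HB.instance Definition _ := Choice.copy (series M) {classic (M -> rat)}.

Lemma seriesP f g : (forall m, f m = g m) <-> f = g.
Proof. by split=> [fg|-> //]; apply: functional_extensionality_dep. Qed.

Definition series_zero : series M := fun=> 0.
Definition series_add f g : series M := fun m => f m + g m.
Definition series_opp f : series M := fun m => - f m.
Definition series_one : series M := fun m => (m == 0)%:R.
Definition series_mul f g : series M :=
  fun m => \sum_(p <- decomp m) f p.1 * g p.2.
Definition series_scale (a : rat) f : series M := fun m => a * f m.

Fact series_addA : associative series_add.
Proof. by move=> f g h; apply/seriesP => m; apply: addrA. Qed.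
Fact series_addC : commutative series_add.
Proof. by move=> f g; apply/seriesP => m; apply: addrC. Qed.
Fact series_add0 : left_id series_zero series_add.
Proof. by move=> f; apply/seriesP => m; apply: add0r. Qed.
Fact series_addN : left_inverse series_zero series_opp series_add.
Proof. by move=> f; apply/seriesP => m; apply: addNr. Qed.

HB.instance Definition _ := GRing.isZmodule.Build (series M)
  series_addA series_addC series_add0 series_addN.

Fact series_mulC : commutative series_mul.
Proof.
move=> f g; apply/seriesP => m; rewrite /series_mul.
have sw : perm_eq (decomp m) [seq (p.2, p.1) | p <- decomp m].
  apply: uniq_perm; rewrite ?decomp_uniq //.
    by rewrite map_inj_uniq ?decomp_uniq // => -[a b] [c d] [-> ->].
  move=> [a b]; rewrite mem_decomp /= addrC.
  apply/eqP/mapP => [ab|[[c d]]].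
    by exists (b, a) => //; rewrite mem_decomp /= ab.
  by rewrite mem_decomp /= => /eqP<- [-> ->]; rewrite addrC.
rewrite (perm_big _ sw) big_map /=.
by apply: eq_bigr => p _; rewrite mulrC.
Qed.

Fact series_mulA : associative series_mul.
Proof.
move=> f g h; apply/seriesP => m; rewrite /series_mul.
under eq_bigr => p _ do rewrite mulr_sumr.
under [RHS]eq_bigr => p _ do rewrite mulr_suml.
pose s1 := [seq (p.1, q) | p <- decomp m, q <- decomp p.2].
pose s2 := [seq (q.1, (q.2, p.2)) | p <- decomp m, q <- decomp p.1].
have -> : \sum_(p <- decomp m) \sum_(q <- decomp p.2) f p.1 * (g q.1 * h q.2)
  = \sum_(x <- s1) f x.1 * (g x.2.1 * h x.2.2).
  by rewrite big_allpairs_dep.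
have -> : \sum_(p <- decomp m) \sum_(q <- decomp p.1) f q.1 * g q.2 * h p.2
  = \sum_(x <- s2) f x.1 * (g x.2.1 * h x.2.2).
  rewrite big_allpairs_dep /=.
  by apply: eq_bigr => p _; apply: eq_bigr => q _; rewrite mulrA.
apply: perm_big; apply: uniq_perm.
- apply: allpairs_uniq_dep; rewrite ?decomp_uniq //.
    by move=> p _; apply: decomp_uniq.
  move=> [[a b] [c d]] [[a' b'] [c' d']].
  move=> /allpairsPdep [[? ?] [[? ?] []]] + + [? ? ? ?].
  move=> + + /allpairsPdep [[? ?] [[? ?] []]] + + [? ? ? ?]; subst.
  rewrite !mem_decomp /= => _ /eqP<- _ /eqP<- [-> -> ->].
  by [].
- apply: allpairs_uniq_dep; rewrite ?decomp_uniq //.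
    by move=> p _; apply: decomp_uniq.
  move=> [[a b] [c d]] [[a' b'] [c' d']].
  move=> /allpairsPdep [[? ?] [[? ?] []]] + + [? ? ? ?].
  move=> + + /allpairsPdep [[? ?] [[? ?] []]] + + [? ? ? ?]; subst.
  rewrite !mem_decomp /= => _ /eqP<- _ /eqP<- [-> -> ->].
  by [].
move=> [a [b c]]; apply/allpairsPdep/allpairsPdep.
- move=> [[x y] [[z w] [+ + [-> -> ->]]]].
  rewrite !mem_decomp /= => /eqP<- /eqP<-.
  by exists (x + z, w), (x, z); rewrite !mem_decomp /= addrA !eqxx.
- move=> [[x y] [[z w] [+ + [-> -> ->]]]].
  rewrite !mem_decomp /= => /eqP<- /eqP<-.
  by exists (z, w + y), (w, y); rewrite !mem_decomp /= addrA !eqxx.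
Qed.

Fact series_mul1 : left_id series_one series_mul.
Proof.
move=> f; apply/seriesP => m; rewrite /series_mul /series_one.
rewrite (bigD1_seq (0, m)) ?decomp_uniq ?mem_decomp /= ?add0r ?eqxx ?mul1r //.
rewrite big_seq_cond big1 ?addr0 // => -[a b]; rewrite mem_decomp /=.
move=> /andP[/eqP abm ab]; case: (eqVneq a 0) => [a0|_]; last by rewrite mul0r.
by move: ab; rewrite -abm a0 add0r eqxx.
Qed.

Fact series_mulDl : left_distributive series_mul +%R.
Proof.
move=> f g h; apply/seriesP => m; rewrite /series_mul [RHS]/+%R /= /series_add.
by rewrite -big_split /=; apply: eq_bigr => p _; rewrite -mulrDl.
Qed.

Fact series_one_neq0 : series_one != 0.
Proof.
by apply/eqP => /seriesP/(_ 0); rewrite /series_one eqxx => /eqP; rewrite oner_eq0.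
Qed.

HB.instance Definition _ := GRing.Zmodule_isComNzRing.Build (series M)
  series_mulA series_mulC series_mul1 series_mulDl series_one_neq0.

Fact series_scaleA a b f :
  series_scale a (series_scale b f) = series_scale (a * b) f.
Proof. by apply/seriesP => m; apply: mulrA. Qed.
Fact series_scale1 : left_id 1 series_scale.
Proof. by move=> f; apply/seriesP => m; apply: mul1r. Qed.
Fact series_scaleDr : right_distributive series_scale +%R.
Proof. by move=> a f g; apply/seriesP => m; apply: mulrDr. Qed.
Fact series_scaleDl f : {morph series_scale^~ f : a b / a + b}.
Proof. by move=> a b; apply/seriesP => m; apply: mulrDl. Qed.

HB.instance Definition _ := GRing.Zmodule_isLmodule.Build rat (series M)
  series_scaleA series_scale1 series_scaleDr series_scaleDl.

Fact series_scaleAl (a : rat) f g : a *: (f * g) = (a *: f) * g.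
Proof.
apply/seriesP => m.
rewrite [LHS](mulr_sumr (decomp m) xpredT (fun p => f p.1 * g p.2) a).
by apply: eq_bigr => p _; rewrite mulrA.
Qed.

HB.instance Definition _ :=
  GRing.Lmodule_isLalgebra.Build rat (series M) series_scaleAl.
HB.instance Definition _ :=
  GRing.Lalgebra_isComAlgebra.Build rat (series M).

Lemma coef_seriesD f g m : (f + g) m = f m + g m. Proof. by []. Qed.
Lemma coef_seriesN f m : (- f) m = - f m. Proof. by []. Qed.
Lemma coef_seriesZ (a : rat) f m : (a *: f) m = a * f m.
Proof. by []. Qed.
Lemma coef_series1 m : (1 : series M) m = (m == 0)%:R. Proof. by []. Qed.
Lemma coef_seriesM f g m :
  (f * g) m = \sum_(p <- decomp m) f p.1 * g p.2.
Proof. by []. Qed.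
Lemma coef_series_sum I (r : seq I) (P : pred I) (F : I -> series M) m :
  (\sum_(i <- r | P i) F i) m = \sum_(i <- r | P i) F i m.
Proof. by elim/big_rec2: _ => // i y f _ <-. Qed.

(* Division of series: [f] is a unit when it has a multiplicative inverse. *)
Definition series_unit : pred (series M) := fun f => `[< exists g, g * f = 1 >].
Definition series_inv f : series M :=
  if pselect (exists g, g * f = 1) is left ex then xchoose (P:=fun g => g * f == 1)
    (let: ex_intro g e := ex in ex_intro _ g (introT eqP e)) else f.

Fact series_mulVr : {in series_unit, left_inverse 1 series_inv *%R}.
Proof.
move=> f /asboolP ex; rewrite /series_inv; case: pselect => // ex'.
by apply/eqP; apply: (xchooseP (P := fun g => g * f == 1)).
Qed.
Fact series_unitP f g : g * f = 1 -> series_unit f.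
Proof. by move=> gf; apply/asboolP; exists g. Qed.
Fact series_invr_out : {in [predC series_unit], series_inv =1 id}.
Proof.
move=> f; rewrite inE /= /series_unit => /asboolPn nex.
by rewrite /series_inv; case: pselect.
Qed.

HB.instance Definition _ := GRing.ComNzRing_hasMulInverse.Build (series M)
  series_mulVr series_unitP series_invr_out.

End SeriesRing.

Definition nat_decomp (m : nat) : seq (nat * nat) :=
  [seq (i, (m - i)%N) | i <- iota 0 m.+1].

Fact nat_decomp_uniq m : uniq (nat_decomp m).
Proof. by rewrite map_inj_uniq ?iota_uniq // => i j []. Qed.

Fact mem_nat_decomp m p : (p \in nat_decomp m) = (p.1 + p.2 == m).
Proof.
case: p => a b; apply/mapP/eqP => [[i]|<-].
  by rewrite mem_iota /= add0n ltnS => im [-> ->]; apply: subnKC.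
exists a; first by rewrite mem_iota /= add0n ltnS; apply: leq_addr.
by congr (_, _); symmetry; apply: addKn.
Qed.

HB.instance Definition _ :=
  hasDecompositions.Build nat nat_decomp_uniq mem_nat_decomp.

Definition fpsT : series nat := fun n => (n == 1)%:R.
Notation "''t'" := fpsT (at level 0).

(* The series \sum_(k >= 0) u k t^(e k), for an injective [e] with [k <= e k]. *)
Definition fps_sum (u : nat -> rat) (e : nat -> nat) : series nat :=
  fun n => \sum_(k < n.+1 | e k == n) u k.

Lemma coef_fpsM (f g : series nat) n :
  (f * g) n = \sum_(i < n.+1) f i * g (n - i)%N.
Proof.
rewrite coef_seriesM big_map -(big_mkord xpredT (fun i => f i * g (n - i)%N)).
by rewrite /index_iota subn0.
Qed.

Lemma fps_unitE (f : series nat) : (f \is a GRing.unit) = (f 0 != 0).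
Proof.
apply/idP/idP => [uf|f0].
  have := congr1 (fun g : series nat => g 0%N) (mulVr uf).
  rewrite coef_fpsM big_ord_recl big_ord0 addr0 subn0 coef_series1 eqxx /=.
  by apply: contra_eq_neq => ->; rewrite mulr0 eq_sym oner_eq0.
pose step s : rat :=
  (f 0)^-1 * (((size s == 0)%N)%:R - \sum_(i < size s) s`_i * f (size s - i)%N).
pose l := fix l n : seq rat :=
  if n is n'.+1 then rcons (l n') (step (l n')) else [::].
have szl n : size (l n) = n by elim: n => //= n IHn; rewrite size_rcons IHn.
pose g : series nat := fun n => (l n.+1)`_n.
have lE n i : (i < n)%N -> (l n)`_i = g i.
  elim: n => // n IHn; rewrite ltnS leq_eqVlt => /orP[/eqP-> //|lt_in].
  by rewrite /= nth_rcons szl lt_in IHn.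
suff gf : g * f = 1 by apply/unitrPr; exists g; rewrite mulrC.
apply/seriesP => n; rewrite coef_fpsM coef_series1 big_ord_recr /= subnn.
have -> : g n = step (l n) by rewrite /g /= nth_rcons szl ltnn eqxx.
rewrite /step szl mulrC mulrA divff // mul1r.
under [X in _ - X]eq_bigr => i _ do rewrite lE //.
by rewrite addrC subrK.
Qed.

Lemma coef_fpsTM (f : series nat) n :
  ('t * f) n = if n is n'.+1 then f n' else 0.
Proof.
rewrite coef_fpsM; case: n => [|n].
  by rewrite big_ord_recl big_ord0 /fpsT /= mul0r addr0.
rewrite big_ord_recl /fpsT /= mul0r add0r big_ord_recl /= mul1r subSS subn0.
by rewrite big1 ?addr0 // => i _; rewrite /= mul0r.
Qed.

Lemma coef_fps_poly (p : {poly rat}) n : horner_alg 't p n = p`_n.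
Proof.
elim/poly_ind: p n => [|p c IHp] n; first by rewrite rmorph0 coef0.
rewrite rmorphD rmorphM /= horner_algX horner_algC mulrC coef_seriesD.
rewrite coef_fpsTM coef_seriesZ coef_series1 coefD coefMX coefC.
by case: n => [|n]; rewrite ?IHp ?mulr1 ?mulr0.
Qed.

Definition odd_powers (n : nat) : series nat :=
  fps_sum (fun k => (k.*2.+1 ^ n)%:R) id.

(* B_n is obtained from B_n(t) = (1 - t)^(n+1) \sum_k (2k+1)^n t^k, whose right
   hand side is a polynomial of degree at most n by [eulerianBE] below. *)
Definition eulerianB (n : nat) : {poly rat} :=
  \poly_(i < n.+1) (((1 - 't) ^+ n.+1 * odd_powers n) i).

Lemma coef_odd_powers n k : odd_powers n k = (k.*2.+1 ^ n)%:R.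
Proof. by rewrite /odd_powers /fps_sum (big_pred1 ord_max). Qed.

Section EulerianB.
Let theta (f : series nat) : series nat := fun n => n%:R * f n.

Let thetaM f g : theta (f * g) = theta f * g + f * theta g.
Proof.
apply/seriesP => n; rewrite coef_seriesD !coef_fpsM /theta coef_fpsM mulr_sumr.
rewrite -big_split /=; apply: eq_bigr => i _.
rewrite -{1}(subnKC (leq_ord i)) natrD mulrDl; congr (_ + _); first by rewrite mulrA.
by rewrite mulrCA.
Qed.

Let U : series nat := 1 - 't.

Let thetaU : theta U = - 't.
Proof.
apply/seriesP => -[|[|n]];
by rewrite /theta /U !(coef_seriesN, coef_seriesD, coef_series1) /fpsT /= ?mul0r
  ?subr0 ?oppr0 ?mulr0 ?sub0r ?mul1r.
Qed.

Let thetaX n : theta (U ^+ n.+1) = - ('t * U ^+ n) *+ n.+1.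
Proof.
elim: n => [|n IHn]; first by rewrite !expr1 expr0 mulr1 thetaU.
rewrite exprS thetaM IHn thetaU [RHS]mulrS mulrnAr; congr (_ + _ *+ _).
  by rewrite mulNr.
by rewrite mulrN mulrCA -exprS.
Qed.

Let odd_powersS n :
  odd_powers n.+1 = odd_powers n + 2%:R *: theta (odd_powers n).
Proof.
apply/seriesP => k; rewrite coef_seriesD coef_seriesZ /theta !coef_odd_powers.
rewrite expnS natrM -natr1 -[in X in X * _]muln2 natrM mulrDl mul1r addrC.
by rewrite -mulrA mulrCA.
Qed.

Lemma eulerianB_poly n : exists2 p : {poly rat}, (size p <= n.+1)%N &
  horner_alg 't p = (1 - 't) ^+ n.+1 * odd_powers n.
Proof.
elim: n => [|n [p szp pE]].
  exists 1; rewrite ?size_poly1 // rmorph1 expr1 mulrBl mul1r.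
  apply/seriesP => k; rewrite coef_seriesD coef_seriesN coef_fpsTM coef_series1.
  by case: k => [|k]; rewrite !coef_odd_powers ?subr0 ?subrr.
have thp : horner_alg 't ('X * p^`()) = theta (horner_alg 't p).
  apply/seriesP => k; rewrite /theta !coef_fps_poly coefXM coef_deriv.
  by case: k => [|k]; rewrite ?mul0r //= mulr_natl.
pose D : {poly rat} := 1 - 'X.
exists (D * p + (D * ('X * p^`())) *+ 2 + ('X * p) *+ n.+1 *+ 2).
  have sz1 : (size D <= 2)%N by rewrite /D -opprB size_polyN size_XsubC.
  have szM (q : {poly rat}) : (size q <= n.+1)%N -> (size (D * q)%R <= n.+2)%N.
    move=> szq; apply: leq_trans (size_polyMleq _ _) _.
    by rewrite -subn1 leq_subLR add1n -[n.+3]/(2 + n.+1)%N leq_add.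
  have szX (q : {poly rat}) m : (size q <= m)%N -> (size ('X * q)%R <= m.+1)%N.
    move=> szq; apply: leq_trans (size_polyMleq _ _) _.
    by rewrite size_polyX /= ltnS.
  have szn (q : {poly rat}) k : (size (q *+ k)%R <= size q)%N.
    by rewrite -scaler_nat size_scale_leq.
  have szp' : (size p^`() <= n)%N.
    apply: leq_trans (size_poly _ _) _.
    by case: (size p) szp => // k /=; rewrite ltnS.
  rewrite (leq_trans (size_polyD _ _)) // geq_max.
  rewrite (leq_trans (size_polyD _ _)) ?geq_max ?szM //=.
    by rewrite !(leq_trans (szn _ _)) // szX.
  by rewrite (leq_trans (szn _ _)) // szM // szX.
have hD q r : horner_alg 't (q + r) = horner_alg 't q + horner_alg 't r.
  exact: rmorphD.
have hM q r : horner_alg 't (q * r) = horner_alg 't q * horner_alg 't r.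
  exact: rmorphM.
have hn q k : horner_alg 't (q *+ k) = horner_alg 't q *+ k by apply: rmorphMn.
have hU : horner_alg 't D = U by rewrite rmorphB rmorph1 /= horner_algX.
rewrite !(hD, hn) !(hM D) thp [horner_alg 't ('X * p)]hM hU horner_algX.
rewrite -/U in pE; rewrite pE thetaM thetaX odd_powersS.
rewrite scaler_nat; set S := odd_powers n; set V := U ^+ n.
rewrite [U ^+ n.+2]exprS [U ^+ n.+1]exprS -/V.
ring.
Qed.
End EulerianB.

Lemma eulerianBE n :
  horner_alg 't (eulerianB n) / (1 - 't) ^+ n.+1 = odd_powers n.
Proof.
have [p szp pE] := eulerianB_poly n.
have -> : eulerianB n = p.
  apply/polyP => i; rewrite coef_poly -pE coef_fps_poly; case: ltnP => // ni.
  by rewrite nth_default // (leq_trans szp).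
have U1 : (1 - 't) ^+ n.+1 \is a GRing.unit.
  rewrite unitrX // fps_unitE.
  by rewrite coef_seriesD coef_seriesN coef_series1 /fpsT subr0 oner_eq0.
by rewrite pE mulrC mulKr.
Qed.

(** Power series in x_1, x_2, ...

   The monomial x_{i_1} ... x_{i_n} is the multiset of its indices; indices
   start at 0, so that [j : nat] stands for the variable x_{j+1}. *)

Section MsetMonoid.
Variable K : choiceType.
Implicit Types A B : {mset K}.

HB.instance Definition _ := Choice.copy {mset K} {fsfun K -> nat with 0%N}.
HB.instance Definition _ := GRing.isNmodule.Build {mset K}
  (@msetDA K) (@msetDC K) (@mset0D K).

Definition mset_decomp A : seq ({mset K} * {mset K}) :=
  [seq (B, A `\` B) | B <- undup [seq seq_mset (mask (b : bitseq) A)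
                                 | b : (size A).-tuple bool]].

Fact mset_decomp_uniq A : uniq (mset_decomp A).
Proof. by rewrite map_inj_uniq ?undup_uniq // => B C []. Qed.

Fact mem_mset_decomp A (p : {mset K} * {mset K}) : (p \in mset_decomp A) = (p.1 + p.2 == A)%R.
Proof.
case: p => B C; rewrite -[(_ + _)%R]/(B `+` C).
apply/mapP/eqP => [[D]|<-].
  rewrite mem_undup => /mapP[b _ ->] [-> ->]; apply: msetBDKC.
  apply/msubsetP => x; rewrite mset_seqE -[A x]count_mem_mset.
  by apply: leq_count_subseq; apply: mask_subseq.
exists B; last by rewrite msetDKB.
have /count_subseqP[s /subseqP[b szb ->] Bs] :
    forall x, (count_mem x B <= count_mem x (B `+` C))%N.
  by move=> x; rewrite !count_mem_mset msetE2 leq_addr.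
rewrite mem_undup; apply/mapP; exists (Tuple (introT eqP szb)).
  exact: mem_enum.
by rewrite -[LHS]seq_mset_id; apply/eq_seq_msetP.
Qed.

HB.instance Definition _ :=
  hasDecompositions.Build {mset K} mset_decomp_uniq mem_mset_decomp.

Lemma mset_addE A B : (A + B)%R = A `+` B. Proof. by []. Qed.

Lemma perm_msetD A B : perm_eq ((A + B)%R : {mset K}) (A ++ B).
Proof.
by apply/allP => x _; rewrite /= count_cat !count_mem_mset mset_addE msetE2.
Qed.

Lemma size_msetD A B : size ((A + B)%R : {mset K}) = (size A + size B)%N.
Proof. by rewrite (perm_size (perm_msetD A B)) size_cat. Qed.

End MsetMonoid.

Notation xseries := (series {mset nat}).

Definition mset_map (s : nat -> nat) (m : {mset nat}) : {mset nat} :=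
  seq_mset (map s m).

Lemma mset_mapD s : {morph mset_map s : A B / A + B}.
Proof.
move=> A B; rewrite -[RHS]seq_mset_id; apply/eq_seq_msetP.
rewrite perm_sym (permPl (perm_msetD _ _)) (permPr (perm_map s (perm_msetD A B))).
by rewrite map_cat perm_cat // perm_eq_seq_mset.
Qed.

Lemma mset_mapK s s' : cancel s s' -> cancel (mset_map s) (mset_map s').
Proof.
move=> sK A; rewrite -[RHS]seq_mset_id; apply/eq_seq_msetP.
by rewrite (permPl (perm_map s' (perm_eq_seq_mset _))) mapK.
Qed.

Lemma size_mset_map s A : size (mset_map s A) = size A.
Proof. by rewrite (perm_size (perm_eq_seq_mset _)) size_map. Qed.

Lemma mset_map0 s : mset_map s 0 = 0.
Proof.
rewrite /mset_map -[0]/(@mset0 nat) enum_mset0 -[RHS]seq_mset_id.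
by rewrite enum_mset0.
Qed.

Lemma mset_map_bij s : bijective s -> bijective (mset_map s).
Proof. by case=> s' sK s'K; exists (mset_map s'); apply: mset_mapK. Qed.

Lemma mset_map_msetn s n a : mset_map s (msetn n a) = msetn n (s a).
Proof.
by rewrite /mset_map enum_msetn map_nseq -[RHS]seq_mset_id enum_msetn.
Qed.

(* A symmetric function is a series of bounded degree that is invariant under
   all permutations of the variables. *)
Definition symmetric_series : pred xseries := fun f => `[<
  (exists d, forall m : {mset nat}, (d < size m)%N -> f m = 0) /\
  (forall s : nat -> nat, bijective s -> forall m, f (mset_map s m) = f m) >].

Lemma symmetric_seriesP f : reflect
  ((exists d, forall m : {mset nat}, (d < size m)%N -> f m = 0) /\
   (forall s : nat -> nat, bijective s -> forall m, f (mset_map s m) = f m))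
  (f \in symmetric_series).
Proof. exact: asboolP. Qed.

Fact symmetric_subring : subring_closed symmetric_series.
Proof.
split=> [|f g|f g].
- apply/symmetric_seriesP; split=> [|s sB m]; rewrite ?coef_series1.
    exists 0%N => m; rewrite coef_series1; case: eqP => // -> /=.
    by rewrite -[0]/(@mset0 nat) size_mset0.
  by rewrite -{1}(mset_map0 s) (inj_eq (bij_inj (mset_map_bij sB))).
- move=> /symmetric_seriesP[[d fd] fs] /symmetric_seriesP[[e ge] gs].
  apply/symmetric_seriesP; split=> [|s sB m]; last first.
    by rewrite !coef_seriesD !coef_seriesN fs ?gs.
  exists (maxn d e) => m; rewrite gtn_max => /andP[dm em].
  by rewrite !coef_seriesD !coef_seriesN fd ?ge // subr0.
move=> /symmetric_seriesP[[d fd] fs] /symmetric_seriesP[[e ge] gs].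
apply/symmetric_seriesP; split=> [|s sB m].
  exists (d + e)%N => m dem; rewrite coef_seriesM big_seq big1 // => -[A B].
  rewrite mem_decomp /= => /eqP mE; rewrite -mE size_msetD in dem.
  have [dA|Ad] := ltnP d (size (A : {mset nat})); first by rewrite fd ?mul0r.
  rewrite ge ?mulr0 // ltnNge; apply: contraL dem => Be.
  by rewrite -leqNgt leq_add.
have [s' sK s'K] := sB.
have pm : perm_eq (decomp (mset_map s m))
    [seq (mset_map s p.1, mset_map s p.2) | p <- decomp m].
  apply: uniq_perm; rewrite ?decomp_uniq //.
    rewrite map_inj_uniq ?decomp_uniq // => -[A B] [C D] [].
    by move=> /(can_inj (mset_mapK sK)) -> /(can_inj (mset_mapK sK)) ->.
  move=> [A B]; rewrite mem_decomp /=; apply/eqP/mapP => [AB|[[C D]]].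
    exists (mset_map s' A, mset_map s' B); last by rewrite /= !(mset_mapK s'K).
    by rewrite mem_decomp /= -mset_mapD AB (mset_mapK sK).
  by rewrite mem_decomp /= => /eqP<- [-> ->]; rewrite mset_mapD.
rewrite !coef_seriesM (perm_big _ pm) big_map /=.
by apply: eq_bigr => p _; rewrite fs ?gs.
Qed.

Fact symmetric_scaler : GRing.scaler_closed symmetric_series.
Proof.
move=> a f /symmetric_seriesP[[d fd] fs]; apply/symmetric_seriesP.
split=> [|s sB m]; last by rewrite !coef_seriesZ fs.
by exists d => m dm; rewrite coef_seriesZ fd ?mulr0.
Qed.

HB.instance Definition _ :=
  GRing.isSubringClosed.Build xseries symmetric_series symmetric_subring.
HB.instance Definition _ :=
  GRing.isScaleClosed.Build rat xseries symmetric_series symmetric_scaler.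

Record symfun := SymFun {
  symfun_val :> xseries;
  symfun_valP : symfun_val \in symmetric_series
}.

HB.instance Definition _ := [isSub for symfun_val].
HB.instance Definition _ := [Choice of symfun by <:].
HB.instance Definition _ := [SubChoice_isSubComNzRing of symfun by <:].
HB.instance Definition _ := [SubZmodule_isSubLmodule of symfun by <:].
HB.instance Definition _ := [SubNzRing_SubLmodule_isSubLalgebra of symfun by <:].
HB.instance Definition _ := [SubLalgebra_isSubAlgebra of symfun by <:].

(* The coefficients of p_i = \sum_j x_j^i, for i >= 1. *)
Definition psum_series (i : nat) : xseries :=
  fun m => `[< exists j, m = msetn i j >]%:R.

Fact psum_symmetric i : psum_series i \in symmetric_series.
Proof.
apply/symmetric_seriesP; split=> [|s [s' sK s'K] m].
  exists i => m im; rewrite /psum_series; case: asboolP => // -[j mE].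
  by rewrite mE enum_msetn size_nseq ltnn in im.
congr (nat_of_bool _)%:R; apply/asbool_equiv_eq; split=> -[j mE].
  by exists (s' j); rewrite -[m](mset_mapK sK) mE mset_map_msetn.
by exists (s j); rewrite mE mset_map_msetn.
Qed.

Definition psum (i : nat) : symfun := SymFun (psum_symmetric i).

(** Homomorphisms on the algebra of symmetric functions

   The power sums freely generate the algebra of symmetric functions, so that
   a homomorphism to a commutative algebra [A] is determined by arbitrary
   images [v i : A] of the p_i, i >= 1. *)

Section PowerSumBasis.

Let pp (s : seq nat) : xseries := \prod_(i <- s) psum_series i.

Let valZ (a : rat) (f : symfun) : symfun_val (a *: f) = a *: symfun_val f.
Proof. by []. Qed.

Let valB (f g : symfun) : symfun_val (f - g) = symfun_val f - symfun_val g.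
Proof. by []. Qed.

Let val_pp s : symfun_val (\prod_(i <- s) psum i) = pp s.
Proof. exact: (rmorph_prod (val : symfun -> xseries)). Qed.

Let val_sum I (r : seq I) (F : I -> symfun) :
  symfun_val (\sum_(i <- r) F i) = \sum_(i <- r) symfun_val (F i).
Proof. exact: (raddf_sum (val : symfun -> xseries)). Qed.

Let msum (s js : seq nat) : {mset nat} :=
  \sum_(p <- zip s js) (msetn p.1 p.2 : {mset nat}).

Let nvar (m : {mset nat}) : nat := size (undup m).

Let msum_cons i s j js : msum (i :: s) (j :: js) = msetn i j + msum s js.
Proof. by rewrite /msum /= big_cons. Qed.

Let msum_nil : msum [::] [::] = 0.
Proof. by rewrite /msum big_nil. Qed.

Let mset_addP (A B : {mset nat}) x : (A + B : {mset nat}) x = (A x + B x)%N.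
Proof. by rewrite mset_addE msetE2. Qed.

Let pp_cons i s (m : {mset nat}) : pp (i :: s) m =
  \sum_(p <- decomp m) psum_series i p.1 * pp s p.2.
Proof. by rewrite /pp big_cons. Qed.

Let psum_ge0 i m : 0 <= psum_series i m.
Proof. exact: ler0n. Qed.

Let pp_ge0 s m : 0 <= pp s m.
Proof.
elim: s m => [|i s IHs] m; first by rewrite /pp big_nil coef_series1 ler0n.
by rewrite pp_cons sumr_ge0 // => p _; rewrite mulr_ge0.
Qed.

Let pp_neq0P s m :
  reflect (exists2 js, size js = size s & m = msum s js) (pp s m != 0).
Proof.
elim: s m => [|i s IHs] m.
  rewrite /pp big_nil coef_series1.
  apply: (iffP idP) => [|[js]].
    by rewrite pnatr_eq0 eqb0 negbK => /eqP ->; exists [::]; rewrite ?msum_nil.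
  by move=> /size0nil -> ->; rewrite msum_nil eqxx oner_eq0.
rewrite pp_cons; apply: (iffP idP) => [nz|].
  have /hasP[[A B] /=] : has (fun p => psum_series i p.1 * pp s p.2 != 0) (decomp m).
    apply: contraNT nz => /hasPn z; apply/eqP.
    by rewrite big_seq big1 // => p /z; rewrite negbK => /eqP.
  rewrite mem_decomp /= mulf_eq0 negb_or => /eqP<- /andP[].
  rewrite /psum_series; case: asboolP => // -[j ->] _ /IHs[js szjs ->].
  by exists (j :: js); rewrite /= ?szjs // msum_cons.
move=> [[|j js] //= [szjs] mE]; rewrite gt_eqF //.
rewrite (bigD1_seq (msetn i j, msum s js)) ?decomp_uniq //=; last first.
  by rewrite mem_decomp /= -msum_cons mE.
apply: ltr_pwDl; last by apply: sumr_ge0 => p _; apply: mulr_ge0.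
rewrite mulr_gt0 //; last first.
  by rewrite lt0r pp_ge0 andbT; apply/IHs; exists js.
by rewrite /psum_series; case: asboolP => // -[]; exists j.
Qed.

Let size_msum s js : size js = size s -> size (msum s js) = sumn s.
Proof.
elim: s js => [|i s IHs] [|j js] //=; first by rewrite msum_nil size_mset0.
by move=> [/IHs szs]; rewrite msum_cons size_msetD szs enum_msetn size_nseq.
Qed.

Let mem_msum s js : size js = size s -> 0%N \notin s -> msum s js =i js.
Proof.
elim: s js => [|i s IHs] [|j js] //=.
  by move=> _ _ x; rewrite msum_nil in_mset mset0E.
move=> [szs]; rewrite !inE negb_or eq_sym -lt0n => /andP[i0 s0] x.
by rewrite msum_cons mset_addE in_msetD IHs // in_msetn i0 inE.
Qed.

Let nvar_msum s js : size js = size s -> 0%N \notin s ->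
  nvar (msum s js) = size (undup js).
Proof.
move=> szs s0; apply/perm_size/uniq_perm; rewrite ?undup_uniq // => x.
by rewrite !mem_undup mem_msum.
Qed.

Let map_msum s js : size js = size s -> 0%N \notin s -> uniq js ->
  map (msum s js) js = s.
Proof.
elim: s js => [|i s IHs] [|j js] //= [szs].
rewrite inE negb_or => /andP[i0 s0] /andP[jjs ujs]; congr (_ :: _).
  rewrite msum_cons mset_addP msetnxx; apply/eqP; rewrite -[X in _ == X]addn0.
  by rewrite eqn_add2l mset_eq0 mem_msum.
rewrite -[RHS](IHs _ szs s0 ujs); apply/eq_in_map => x xjs.
rewrite msum_cons mset_addP msetnE; case: eqP => // xj.
by rewrite -xj xjs in jjs.
Qed.

Let part := [pred s : seq nat | sorted geq s && (0%N \notin s)].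

Let part_eq s t : part s -> part t -> perm_eq s t -> s = t.
Proof.
have tr : transitive geq by move=> y x z yx zy; apply: leq_trans zy yx.
have an : antisymmetric geq.
  by move=> x y xy; apply/eqP; rewrite eqn_leq andbC.
by move=> /andP[ss _] /andP[st _]; apply: (sorted_eq tr an).
Qed.

Let mpart (s : seq nat) := msum s (iota 0 (size s)).

Let nvar_mpart s : part s -> nvar (mpart s) = size s.
Proof.
move=> /andP[_ s0]; rewrite nvar_msum ?size_iota //.
by rewrite undup_id ?iota_uniq // size_iota.
Qed.

Let pp_mpart s : pp s (mpart s) != 0.
Proof. by apply/pp_neq0P; exists (iota 0 (size s)); rewrite ?size_iota. Qed.

(* A monomial of p_s involves at most [size s] variables; one that involves
   exactly [size s] of them has the parts of s as exponents. *)
Let pp_nvar s (m : {mset nat}) : part s -> pp s m != 0 -> (nvar m <= size s)%N.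
Proof.
move=> /andP[_ s0] /pp_neq0P[js szs ->]; rewrite nvar_msum // -szs.
exact: size_undup.
Qed.

Let pp_expo s (m : {mset nat}) : part s -> pp s m != 0 -> nvar m = size s ->
  perm_eq (map m (undup m)) s.
Proof.
move=> /andP[_ s0] /pp_neq0P[js szs mE] ns.
have ujs : uniq js.
  by apply: contraT; rewrite -ltn_size_undup szs -ns mE nvar_msum ?ltnn.
rewrite -[X in perm_eq _ X](map_msum szs s0 ujs) -mE; apply: perm_map.
by apply: uniq_perm; rewrite ?undup_uniq // => x; rewrite mem_undup mE mem_msum.
Qed.

Let pp_indep (S : seq (seq nat)) (c : seq nat -> rat) :
  uniq S -> all part S -> \sum_(s <- S) c s *: pp s = 0 ->
  {in S, forall s, c s = 0}.
Proof.
move=> uS /allP pS S0.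
pose mx := \max_(s <- S) size s.
suff H j s : s \in S -> (mx < size s + j)%N -> c s = 0.
  by move=> s sS; apply: (H mx.+1) => //; rewrite addnS ltnS leq_addl.
elim: j s => [|j IHj] s sS; first by rewrite addn0 ltnNge leq_bigmax_seq.
move=> ms; have := congr1 (fun f : xseries => f (mpart s)) S0.
rewrite (bigD1_seq s) //= [RHS]/(0 : rat) coef_seriesD coef_series_sum.
rewrite big_seq_cond big1 ?addr0 => [|t /andP[tS ts]].
  move/eqP; rewrite [X in X == _]coef_seriesZ mulf_eq0 => /orP[/eqP //|].
  by rewrite (negbTE (pp_mpart _)).
rewrite [LHS]coef_seriesZ; apply/eqP; rewrite mulf_eq0 -[_ || _]negbK negb_or.
apply/negP => /andP[ct0 pt].
have st : (size s <= size t)%N.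
  by rewrite -(nvar_mpart (pS _ sS)); apply: pp_nvar pt; apply: pS.
have [lt_st|le_ts] := ltnP (size s) (size t).
  rewrite IHj ?eqxx // in ct0.
  by apply: leq_trans ms _; rewrite addnS -addSn leq_add2r.
have eqs : size s = size t by apply/eqP; rewrite eqn_leq st.
have p1 := pp_expo (pS _ sS) (pp_mpart s) (nvar_mpart (pS _ sS)).
have p2 := pp_expo (pS _ tS) pt (etrans (nvar_mpart (pS _ sS)) eqs).
have := part_eq (pS _ tS) (pS _ sS); rewrite -(permPl p2) => /(_ p1) ets.
by rewrite ets eqxx in ts.
Qed.

Let extend_bij (js : seq nat) : uniq js ->
  exists2 s : nat -> nat, bijective s & map s (iota 0 (size js)) = js.
Proof.
elim/last_ind: js => [|js j IHjs]; first by exists id => //; exists id.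
rewrite rcons_uniq => /andP[jjs /IHjs[s sB sE]].
pose n := size js; pose a := s n.
pose tau x := if x == a then j else if x == j then a else x.
have tauK : involutive tau.
  move=> x; rewrite /tau; case: (eqVneq x a) => [->|xa].
    by rewrite eqxx; case: eqP.
  by case: (eqVneq x j) => [->|xj]; rewrite ?eqxx // (negbTE xa) (negbTE xj).
exists (tau \o s); first by apply: bij_comp => //; exists tau.
rewrite size_rcons -addn1 iotaD map_cat /= -cats1; congr (_ ++ _); last first.
  by rewrite /tau /= add0n eqxx.
rewrite -[RHS]sE; apply/eq_in_map => i; rewrite mem_iota /= add0n => i_n.
have : s i \in js by rewrite -sE map_f // mem_iota.
rewrite /tau /a (inj_eq (bij_inj sB)) ltn_eqF //.
by case: eqP => // -> jj; rewrite jj in jjs.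
Qed.

Let mset_map_msum s t js :
  mset_map s (msum t js) = msum t (map s js).
Proof.
elim: t js => [|i t IHt] [|j js]; rewrite /msum /= ?big_nil ?mset_map0 //.
rewrite !big_cons mset_mapD mset_map_msetn; congr (_ + _); exact: IHt.
Qed.

Let mset_type (m : {mset nat}) : exists t, [/\ part t, size t = nvar m,
   sumn t = size m & forall f : symfun, symfun_val f m = symfun_val f (mpart t)].
Proof.
pose js := sort (relpre m geq) (undup m).
have pj : perm_eq js (undup m) by rewrite perm_sort.
have ujs : uniq js by rewrite (perm_uniq pj) undup_uniq.
have mjs x : (x \in js) = (x \in m) by rewrite (perm_mem pj) mem_undup.
pose t := map m js; have szt : size js = size t by rewrite size_map.
have t0 : 0%N \notin t.
  apply/negP => /mapP[x]; rewrite mjs => xm /esym/eqP.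
  by rewrite mset_eq0 xm.
have mE : m = msum t js.
  apply/msetP => x; case: (boolP (x \in m)) => xm.
    have xjs : x \in js by rewrite mjs.
    have := congr1 (fun l => nth 0%N l (index x js)) (map_msum szt t0 ujs).
    by rewrite /t !(nth_map 0%N) ?index_mem // nth_index.
  have -> : m x = 0%N by apply/eqP; rewrite mset_eq0.
  by symmetry; apply/eqP; rewrite mset_eq0 mem_msum // mjs.
exists t; split.
- rewrite /= t0 andbT sorted_map; apply: sort_sorted => x y /=.
  exact: leq_total.
- by rewrite -szt (perm_size pj).
- by rewrite [in RHS]mE size_msum.
move=> [f fsym] /=; have [s sB sE] := extend_bij ujs.
have /symmetric_seriesP[_ fs] := fsym.
by rewrite -(fs s sB (mpart t)) /mpart mset_map_msum -szt sE -mE.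
Qed.

Definition pexpr (A : comAlgType rat) (v : nat -> A) (L : seq (rat * seq nat)) : A :=
  \sum_(x <- L) x.1 *: \prod_(i <- x.2) v i.

Definition pexpr_pos (L : seq (rat * seq nat)) := all (fun x => 0%N \notin x.2) L.

Let gen_step d l (f : symfun) :
  (forall m : {mset nat}, (d < size m)%N -> symfun_val f m = 0) ->
  (forall m : {mset nat}, (l < nvar m)%N -> symfun_val f m = 0) ->
  exists2 L, pexpr_pos L & pexpr psum L = f.
Proof.
elim: l f => [|l IHl] f fd fl.
  exists [:: (symfun_val f 0, [::])] => //; rewrite /pexpr big_seq1 /= big_nil.
  apply/val_inj/seriesP => m; rewrite linearZ rmorph1 /= coef_seriesZ.
  rewrite coef_series1; case: eqP => [->|m0]; rewrite ?mulr1 //.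
  rewrite mulr0 fl // lt0n /nvar size_eq0; apply/negP => /eqP/undup_nil mn.
  by apply: m0; rewrite -[LHS]seq_mset_id mn -[RHS]seq_mset_id enum_mset0.
pose S := undup [seq s <- [seq map val (t : seq _) | t : l.+1.-tuple 'I_d.+1]
                | part s && (sumn s <= d)%N].
have memS s : (s \in S) = [&& part s, size s == l.+1 & (sumn s <= d)%N].
  rewrite mem_undup mem_filter -andbA; congr (_ && _); rewrite andbC.
  have [sd|_] := boolP (sumn s <= d)%N; last by rewrite !andbF.
  rewrite !andbT; apply/mapP/eqP => [[t _ ->]|szs].
    by rewrite size_map size_tuple.
  have szo : size (map (@inord d) s) == l.+1 by rewrite size_map szs.
  exists (Tuple szo); first by rewrite mem_enum.
  rewrite -map_comp -[LHS]map_id; apply/eq_in_map => i si.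
  rewrite /= inordK // ltnS; apply: leq_trans sd.
  elim: s si {szs szo} => //= j s IHs; rewrite inE => /orP[/eqP->|/IHs ij].
    exact: leq_addr.
  exact: leq_trans ij (leq_addl _ _).
pose c s := symfun_val f (mpart s) / pp s (mpart s).
pose L := [seq (c s, s) | s <- S].
have posL : pexpr_pos L.
  apply/allP => x /mapP[s]; rewrite memS => /and3P[/andP[_ s0] _ _] -> /=.
  exact: s0.
have LE m : symfun_val (pexpr psum L) m = \sum_(s <- S) c s * pp s m.
  transitivity ((\sum_(s <- S) c s *: pp s) m); last by rewrite coef_series_sum.
  congr (_ m).
  by rewrite /pexpr big_map val_sum; apply: eq_bigr => s _; rewrite valZ val_pp.
have ppz s (m : {mset nat}) : s \in S -> (d < size m)%N || (l.+1 < nvar m)%N -> pp s m = 0.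
  rewrite memS => /and3P[ps /eqP szs sd] dl; apply/eqP.
  apply: contraLR dl => pm; rewrite negb_or -!leqNgt -szs pp_nvar // andbT.
  case/pp_neq0P: pm => js szjs ->; rewrite size_msum //.
have [|m lm|L' posL' L'E] := IHl (f - pexpr psum L).
- move=> m dm; rewrite valB coef_seriesD coef_seriesN fd // LE.
  by rewrite big_seq big1 ?subrr // => s sS; rewrite ppz ?mulr0 ?dm.
- rewrite valB coef_seriesD coef_seriesN LE.
  have [lm'|ml] := ltnP l.+1 (nvar m).
    rewrite fl // big_seq big1 ?subrr // => s sS.
    by rewrite ppz ?mulr0 ?lm' ?orbT.
  have [dm|md] := ltnP d (size m).
    by rewrite fd // big_seq big1 ?subrr // => s sS; rewrite ppz ?mulr0 ?dm.
  have nm : nvar m = l.+1 by apply/eqP; rewrite eqn_leq ml lm.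
  have [t [pt szt sumt tE]] := mset_type m.
  have tS : t \in S by rewrite memS pt szt nm eqxx sumt md.
  have pE : pp t m = pp t (mpart t).
    by rewrite -val_pp tE.
  rewrite (bigD1_seq t) ?undup_uniq //= big_seq_cond big1 => [|s].
    by rewrite addr0 tE pE /c divfK ?subrr // pp_mpart.
  move=> /andP[sS st]; apply/eqP; rewrite mulf_eq0; apply/orP; right.
  apply: contraNT st => pm; apply/eqP; have := sS.
  rewrite memS => /and3P[ps /eqP szs _]; apply: part_eq => //.
  have := pp_expo ps pm (etrans nm (esym szs)); rewrite perm_sym => /permPl->.
  apply: (pp_expo pt); rewrite ?szt // pE; exact: pp_mpart.
exists (L ++ L'); first by rewrite /pexpr_pos all_cat [all _ L]posL.
by rewrite /pexpr big_cat /= -/(pexpr _ L) -/(pexpr _ L') L'E addrC subrK.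
Qed.

Lemma psum_generate f : exists L, pexpr_pos L /\ pexpr psum L = f.
Proof.
have /symmetric_seriesP[[d fd] _] := symfun_valP f.
have [|L pL LE] := @gen_step d d f fd; last by exists L.
move=> m dm; apply: fd; apply: leq_trans dm _; exact: size_undup.
Qed.

Section Morphism.
Variables (A : comAlgType rat) (v : nat -> A).

Lemma pexpr_eq0 L : pexpr_pos L -> pexpr psum L = 0 -> pexpr v L = 0.
Proof.
move=> /allP posL L0; pose key (x : rat * seq nat) := sort geq x.2.
pose S := undup (map key L).
pose c s := \sum_(x <- L | key x == s) x.1.
have group (B : comAlgType rat) (w : nat -> B) :
    pexpr w L = \sum_(s <- S) c s *: \prod_(i <- s) w i.
  under eq_bigr => s _ do rewrite scaler_suml.
  rewrite (exchange_big_dep xpredT) //= /pexpr; apply: eq_big_seq => x xL.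
  rewrite (eq_bigl (pred1 (key x))); last by move=> s; rewrite /= eq_sym.
  have fS : filter (pred1 (key x)) S = [:: key x].
    by rewrite filter_pred1_uniq ?undup_uniq // mem_undup map_f.
  rewrite -[RHS]big_filter [filter _ S]fS big_seq1.
  by congr (_ *: _); apply/esym/perm_big/permEl/perm_sort.
rewrite group big_seq big1 // => s sS.
suff -> : c s = 0 by rewrite scale0r.
apply: (pp_indep (undup_uniq _) _ _ sS).
  apply/allP => t; rewrite mem_undup => /mapP[x xL ->].
  have tot : total geq by move=> i j; apply: (leq_total j i).
  by rewrite /= (sort_sorted tot) mem_sort posL.
have := congr1 symfun_val L0; rewrite group val_sum => S0; rewrite -[RHS]S0.
by apply: eq_bigr => t _; rewrite valZ val_pp.
Qed.

Definition psum_hom (f : symfun) : A :=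
  pexpr v (projT1 (cid (psum_generate f))).

Let scaleL (a : rat) L : seq (rat * seq nat) := [seq (a * x.1, x.2) | x <- L].

Let pexpr_scale (B : comAlgType rat) (w : nat -> B) a L :
  pexpr w (scaleL a L) = a *: pexpr w L.
Proof.
by rewrite /pexpr big_map scaler_sumr; apply: eq_bigr => x _; rewrite scalerA.
Qed.

Let pexpr_cat (B : comAlgType rat) (w : nat -> B) L L' :
  pexpr w (L ++ L') = pexpr w L + pexpr w L'.
Proof. by rewrite /pexpr big_cat. Qed.

Let pos_scale a L : pexpr_pos (scaleL a L) = pexpr_pos L.
Proof. by rewrite /pexpr_pos all_map. Qed.

Lemma psum_homE L : pexpr_pos L -> psum_hom (pexpr psum L) = pexpr v L.
Proof.
move=> pL; rewrite /psum_hom; case: cid => L' [/= pL' L'E].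
apply/eqP; rewrite -subr_eq0 -scaleN1r -pexpr_scale -pexpr_cat; apply/eqP.
apply: pexpr_eq0; first by rewrite /pexpr_pos all_cat [all _ L']pL' [all _ _]pos_scale.
by rewrite pexpr_cat pexpr_scale scaleN1r L'E subrr.
Qed.

Fact psum_hom_linear : linear psum_hom.
Proof.
move=> a f g; have [L [pL <-]] := psum_generate f.
have [L' [pL' <-]] := psum_generate g.
rewrite -pexpr_scale -pexpr_cat !psum_homE // ?pexpr_cat ?pexpr_scale //.
by rewrite /pexpr_pos all_cat [all _ L']pL' [all _ _]pos_scale [pexpr_pos _]pL.
Qed.

Fact psum_hom_monoid : monoid_morphism psum_hom.
Proof.
split=> [|f g].
  have -> : (1 : symfun) = pexpr psum [:: (1, [::])].
    by rewrite /pexpr big_seq1 big_nil scale1r.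
  by rewrite psum_homE // /pexpr big_seq1 big_nil scale1r.
have [L [pL <-]] := psum_generate f; have [L' [pL' <-]] := psum_generate g.
pose LL := [seq (x.1 * y.1, x.2 ++ y.2) | x <- L, y <- L'].
have LLE (B : comAlgType rat) (w : nat -> B) :
    pexpr w LL = pexpr w L * pexpr w L'.
  rewrite /pexpr big_allpairs_dep /= mulr_suml; apply: eq_bigr => x _.
  rewrite mulr_sumr; apply: eq_bigr => y _.
  by rewrite big_cat -scalerAl -scalerAr scalerA.
have pLL : pexpr_pos LL.
  apply/allP => z /allpairsP[[x y] [xL yL ->]] /=.
  by rewrite mem_cat negb_or (allP pL) ?(allP pL').
by rewrite -LLE !psum_homE // LLE.
Qed.

HB.instance Definition _ :=
  GRing.isLinear.Build rat symfun A *:%R psum_hom psum_hom_linear.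
HB.instance Definition _ :=
  GRing.isMonoidMorphism.Build symfun A psum_hom psum_hom_monoid.

Lemma psum_hom_psum i : (0 < i)%N -> psum_hom (psum i) = v i.
Proof.
move=> i0; have pE (B : comAlgType rat) (w : nat -> B) :
    w i = pexpr w [:: (1, [:: i])].
  by rewrite /pexpr big_seq1 big_seq1 scale1r.
by rewrite pE psum_homE -?pE // /pexpr_pos /= inE eq_sym -lt0n i0.
Qed.

Lemma psum_hom_unique (phi : {lrmorphism symfun -> A}) :
  (forall i, (0 < i)%N -> phi (psum i) = v i) -> phi =1 psum_hom.
Proof.
move=> phiE f; have [L [pL <-]] := psum_generate f.
rewrite psum_homE // /pexpr raddf_sum; apply: eq_big_seq => x xL.
rewrite /= linearZ rmorph_prod /=; congr (_ *: _); apply: eq_big_seq => i ix.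
rewrite phiE // lt0n; apply: contraNneq (allP pL _ xL) => <-.
exact: ix.
Qed.

End Morphism.
End PowerSumBasis.

(* [f[a]], where [psi i] is the operation of the ambient algebra that replaces
   every variable by its [i]th power. *)
Definition plethysm (A : comAlgType rat) (psi : nat -> A -> A) (a : A)
    (f : symfun) : A := psum_hom (fun i => psi i a) f.

(* Theta_{1,k}(f) = f[k(1 - alpha)] at alpha = -1, with alpha = 'X. *)
Definition Theta1 (k : int) (f : symfun) : rat :=
  (plethysm (fun i (b : {poly rat}) => b \Po 'X^i) ((1 - 'X) *~ k) f).[-1].

Lemma Theta1_psum k i :
  (0 < i)%N -> Theta1 k (psum i) = k%:~R * (1 - (-1) ^+ i).
Proof.
move=> i0; rewrite /Theta1 /plethysm psum_hom_psum // raddfMz /= rmorphB /=.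
rewrite rmorph1 /= comp_polyX -scaler_int hornerZ hornerD hornerN hornerXn.
by rewrite hornerC.
Qed.

(* f[X + 1]: replacing every variable by its ith power turns X + 1 into p_i + 1. *)
Definition plethysm_X1 (f : symfun) : symfun :=
  psum_hom (fun i => psum i + 1) f.

(* The one-line notation pi(1) ... pi(n), with letters in {1, ..., n}. *)
Definition word n (pi : 'S_n) : seq nat := [seq (val (pi i)).+1 | i : 'I_n].

(* Positions in a word are numbered from 0. *)
Definition is_descent (w : seq nat) (i : nat) : bool :=
  (i.+1 < size w)%N && (nth 0%N w i.+1 < nth 0%N w i)%N.

Definition des (w : seq nat) : nat := count (is_descent w) (iota 0 (size w)).

Definition monotone (w : seq nat) : bool := sorted ltn w || sorted gtn w.

(* The nonempty consecutive subsequences, as pairs (first, last) of positions. *)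
Definition factors (w : seq nat) : seq (nat * nat) :=
  [seq (i, j) | i <- iota 0 (size w), j <- iota i (size w - i)].
Definition factor (w : seq nat) (p : nat * nat) : seq nat :=
  drop p.1 (take p.2.+1 w).

Definition is_birun (w : seq nat) (p : nat * nat) : bool :=
  monotone (factor w p) &&
  all (fun q => [&& (q.1 <= p.1)%N, (p.2 <= q.2)%N & monotone (factor w q)]
                ==> (q == p)) (factors w).

Definition is_updown_run (w : seq nat) (p : nat * nat) : bool :=
  is_birun w p || (p == (0, 0)%N) && is_descent w 0.

Definition udr (w : seq nat) : nat := count (is_updown_run w) (factors w).

Example updown_runs_71462853 :
  let w := [:: 7; 1; 4; 6; 2; 8; 5; 3]%N in
  [seq factor w p | p <- factors w & is_updown_run w p] =
  [:: [:: 7]; [:: 7; 1]; [:: 1; 4; 6]; [:: 6; 2]; [:: 2; 8]; [:: 8; 5; 3]]%N.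
Proof. by []. Qed.

Definition Pudr n (Pi : {set 'S_n}) : {poly rat} :=
  \sum_(pi in Pi) 'X^(udr (word pi)).

Definition eulerian (n : nat) : {poly rat} :=
  if (0 < n)%N then \sum_(pi : 'S_n) 'X^((des (word pi)).+1) else 1.

(* [i_1; ...; i_n] indexes a term x_{i_1} ... x_{i_n} of F_pi, for [w] the
   one-line notation of pi. *)
Definition compatible (w s : seq nat) : bool :=
  [&& size s == size w, sorted leq s &
      all (fun j => is_descent w j ==> (nth 0 s j < nth 0 s j.+1)%N)
          (iota 0 (size w))].

(* The coefficient of the monomial m in F_pi is the number of sequences s with
   x_{s_1} ... x_{s_n} = m that index a term of F_pi; those with the right
   product are the distinct rearrangements of m. *)
Definition Fquasi (w : seq nat) : xseries :=
  fun m => (count (compatible w) (permutations (m : {mset nat})))%:R.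

Definition Qgf n (Pi : {set 'S_n}) : xseries :=
  \sum_(pi in Pi) Fquasi (word pi).

Definition is_partition (n : nat) (s : seq nat) : bool :=
  [&& sorted geq s, 0%N \notin s & sumn s == n].

(* A partition of n has at most n parts, each at most n. *)
Record intpart (n : nat) := IntPart {
  intpart_val : n.-bseq 'I_n.+1;
  intpart_valP : is_partition n [seq val i | i <- intpart_val]
}.

HB.instance Definition _ n := [isSub for @intpart_val n].
HB.instance Definition _ n := [Finite of intpart n by <:].

Coercion parts n (l : intpart n) : seq nat :=
  [seq val i | i <- intpart_val l].

Lemma intpart_onto n (s : seq nat) :
  is_partition n s -> exists l : intpart n, parts l = s.
Proof.
move=> ps; have /and3P[_ s0 /eqP sn] := ps.
have le_sn i : i \in s -> (i < n.+1)%N.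
  rewrite ltnS -sn; elim: (s) => //= j s' IHs.
  rewrite inE => /orP[/eqP->|/IHs ij]; first exact: leq_addr.
  exact: leq_trans ij (leq_addl _ _).
have szs : (size [seq inord i : 'I_n.+1 | i <- s] <= n)%N.
  rewrite size_map -sn; elim: s s0 {ps sn le_sn} => //= j s IHs.
  rewrite inE negb_or eq_sym -lt0n => /andP[j0 /IHs les].
  by rewrite -add1n leq_add.
have vs : [seq val i | i <- Bseq szs] = s.
  rewrite -[RHS]map_id -map_comp; apply/eq_in_map => i si.
  by rewrite /= inordK // le_sn.
have pl : is_partition n [seq val i | i <- Bseq szs] by rewrite vs.
by exists (IntPart pl).
Qed.

(* The value at p_i := [v i] of the polynomial \sum_l c_l p_l. *)
Definition psum_poly n (c : intpart n -> rat) (A : comAlgType rat)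
    (v : nat -> A) : A :=
  \sum_(l : intpart n) c l *: \prod_(i <- parts l) v i.

(* Main.v *)
Require Import Defs.
From HB Require Import structures.
From mathcomp Require Import all_boot all_order all_algebra all_fingroup.
From mathcomp Require Import boolp finmap multiset ring zify.

Set Implicit Arguments.
Unset Strict Implicit.
Unset Printing Implicit Defensive.

Import Order.TTheory GRing.Theory Num.Theory.
Local Open Scope ring_scope.

(** The left hand side is a sum over pi in Pi, the two series on the right only
   depend on the symmetric function Q(Pi), and both are generating functions of
   the same numbers: the coefficient of t^r counts the ways of cutting pi into
   r consecutive, possibly empty blocks that alternately increase and decrease,
   an increasing block first.

   On the side of symmetric functions, a block that increases is what a variable
   selects in F_pi, and a block that decreases is what a negative variable
   selects at alpha = -1. Hence the r alternating blocks evaluate F_pi at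
   1 - alpha + 1 - alpha + ... (r terms), and Q(Pi) evaluated there is
   Theta_{1,k}(Q) for r = 2k and Theta_{1,k}(Q[X+1]) for r = 2k + 1. The point
   is that this evaluation of the F_pi, summed over Pi, agrees with the evaluation
   of the power sums (lemma [sum_fillings]). For ordinary variables it is a
   ring homomorphism ([spec]). A negative variable of value z is reached by
   interpolation: insert N ordinary variables of value -z at the same place. Both
   sides are polynomials in N, and N = -1 amounts to the negative variable, since
   the transfer operators of an increasing block of value -z and a decreasing
   block of value z are mutually inverse ([cutK], [fillings_signed]).

   On the side of words, a transfer argument along pi shows that every letter
   multiplies the generating function by (1+t^2)/(1-t^2) when the direction of pi
   is kept and by 2t/(1-t^2) when it changes ([filling_gf_turns]), where pi is
   thought of as starting upwards. The number of changes is udr(pi) - 1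
   ([udr_turns]), because every maximal monotone factor but the first starts at a
   change of direction.

   The remaining two expressions follow from the values of Theta_{1,k} on
   power sums: a product over the parts of lambda gives (2k)^l or 0, respectively
   (2k+1)^o, and the sums over k are Eulerian series in t^2. That
   \sum_k k^m t^k = A_m(t)/(1-t)^(m+1) is proved by the same transfer argument
   with increasing blocks only, the number k^m of maps being split according to
   the permutation that sorts them ([eulerianE]). *)

(** * Cutting a word into monotone blocks *)

(** A letter of a signed alphabet: [(true, z)] is an ordinary variable of value z,
   [(false, z)] is a negative variable - alpha z, taken at alpha = -1. *)
Definition letter := (bool * rat)%type.

Definition step (b : bool) : rel nat := if b then leq else gtn.
Arguments step !b : simpl nomatch.

Definition block (b : bool) (u : seq nat) : bool := sorted (step b) u.

Definition cut (l : letter) (phi : seq nat -> rat) (w : seq nat) : rat :=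
  \sum_(j < (size w).+1) (block l.1 (take j w))%:R * l.2 ^+ j * phi (drop j w).

(** The letter x, already read, belongs to the current block. *)
Definition cut_after (l : letter) (x : nat) (phi : seq nat -> rat) (w : seq nat) : rat :=
  \sum_(j < (size w).+1) (block l.1 (x :: take j w))%:R * l.2 ^+ j * phi (drop j w).

(** The value of F_w on the signed alphabet ls: a variable takes a block without
   descent, a negative variable a block without ascent. *)
Definition fillings (ls : seq letter) : seq nat -> rat :=
  foldr cut (fun w => (w == [::])%:R) ls.

Definition letter_psum (i : nat) (ls : seq letter) : rat :=
  \sum_(l <- ls) (if l.1 then l.2 ^+ i else - (- l.2) ^+ i).

Lemma cut_nil l phi : cut l phi [::] = phi [::].
Proof. by rewrite /cut big_ord1 /= /block /= expr0 !mul1r. Qed.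

Lemma cut_cons l phi x w :
  cut l phi (x :: w) = phi (x :: w) + l.2 * cut_after l x phi w.
Proof.
rewrite /cut big_ord_recl /= /block /= expr0 !mul1r /cut_after mulr_sumr.
congr (_ + _); apply: eq_bigr => j _; rewrite /bump /= add1n /block exprS.
by rewrite !mulrA; congr (_ * _ * _); rewrite mulrC.
Qed.

Lemma cut_after_nil l x phi : cut_after l x phi [::] = phi [::].
Proof. by rewrite /cut_after big_ord1 /= /block /= expr0 !mul1r. Qed.

Lemma cut_after_cons l x phi y w : cut_after l x phi (y :: w) =
  if step l.1 x y then cut l phi (y :: w) else phi (y :: w).
Proof.
rewrite /cut_after big_ord_recl /= /block /= expr0 !mul1r; case: ifP => xy.
  rewrite cut_cons /cut_after mulr_sumr. congr (_ + _); apply: eq_bigr => j _.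
  rewrite /bump /= add1n /block exprS /= !mulrA.
  by congr (_ * _ * _); rewrite mulrC.
rewrite big1 ?addr0 // => j _ /=.
by rewrite !mul0r.
Qed.

(** A nonempty prefix that first increases and then decreases has exactly two cuts
   into an increasing and a decreasing block, just before or just after its
   last maximum; their signs are opposite, so that only the empty prefix survives. *)
Lemma cutK z phi : cut (true, - z) (cut (false, z) phi) =1 phi.
Proof.
have step_cons x w : cut_after (true, - z) x (cut (false, z) phi) w =
    cut_after (false, z) x phi w ->
    cut (true, - z) (cut (false, z) phi) (x :: w) = phi (x :: w).
  by move=> e; rewrite !cut_cons e /= mulNr addrK.
suff e w x : cut_after (true, - z) x (cut (false, z) phi) w =
    cut_after (false, z) x phi w.
  by case=> [|x w]; [rewrite !cut_nil | apply: step_cons].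
elim: w x => [|y w IHw] x; first by rewrite !cut_after_nil cut_nil.
by rewrite !cut_after_cons /= [(y < x)%N]ltnNge; case: leqP => //= _; apply: step_cons.
Qed.

(** * Finite differences *)

Definition diff (s : nat -> rat) : nat -> rat := fun N => s N.+1 - s N.

Lemma diffE s N : diff s N = s N.+1 - s N. Proof. by []. Qed.

(** Equivalently, s is a polynomial function of degree less than m. *)
Definition polylike (m : nat) (s : nat -> rat) : Prop :=
  forall N, iter m diff s N = 0.

Lemma eq_polylike m s s' : s =1 s' -> polylike m s -> polylike m s'.
Proof. by move=> /funext ->. Qed.

Lemma polylikeS m s : polylike m (diff s) <-> polylike m.+1 s.
Proof. by rewrite /polylike; split=> h N; have := h N; rewrite -iterSr. Qed.

Lemma polylikeW m k s : (m <= k)%N -> polylike m s -> polylike k s.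
Proof.
move=> /subnK <- h; elim: (k - m)%N => [|j IHj] // N.
by rewrite addSn iterS diffE !IHj subrr.
Qed.

Lemma polylike_lin m I (r : seq I) (Q : pred I) (c : I -> rat)
    (s : I -> nat -> rat) : (forall i, polylike m (s i)) ->
  polylike m (fun N => \sum_(i <- r | Q i) c i * s i N).
Proof.
elim: m s => [|m IHm] s h.
  by move=> N /=; rewrite big1 // => i _; rewrite (h i N : s i N = 0) mulr0.
apply/polylikeS.
apply: (@eq_polylike _ (fun N => \sum_(i <- r | Q i) c i * diff (s i) N)).
  by move=> N; rewrite [RHS]diffE -sumrB; apply: eq_bigr => i _; rewrite diffE mulrBr.
by apply: IHm => i; apply/polylikeS.
Qed.

Lemma polylikeD m s s' : polylike m s -> polylike m s' ->
  polylike m (fun N => s N + s' N).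
Proof.
move=> hs hs'.
apply: (@eq_polylike _ (fun N => \sum_(b <- [:: true; false])
    1 * (if b then s else s') N)).
  by move=> N; rewrite big_cons big_seq1 !mul1r.
by apply: polylike_lin => -[].
Qed.

Lemma polylikeZ m a s : polylike m s -> polylike m (fun N => a * s N).
Proof.
move=> hs; apply: (@eq_polylike _ (fun N => \sum_(b <- [:: tt]) a * s N)).
  by move=> N; rewrite big_seq1.
by apply: polylike_lin.
Qed.

(** The Leibniz rule: the difference of a product with an affine function is a
   difference of s times another affine function, plus a multiple of s. *)
Lemma polylike_affine m a b s :
  polylike m s -> polylike m.+1 (fun N => (a + N%:R * b) * s N).
Proof.
elim: m a s => [|m IHm] a s hs; apply/polylikeS.
  by move=> N /=; rewrite diffE !(hs _ : s _ = 0) !mulr0 subrr.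
apply: (@eq_polylike _ (fun N => (a + b + N%:R * b) * diff s N + b * s N)).
  by move=> N; rewrite !diffE -natr1; ring.
apply: polylikeD; last exact: polylikeZ.
by apply: IHm; apply/polylikeS.
Qed.

Lemma polylike_prod (s : seq nat) (a b : nat -> rat) :
  polylike (size s).+1 (fun N => \prod_(i <- s) (a i + N%:R * b i)).
Proof.
elim: s => [|i s IHs].
  by apply/polylikeS => N /=; rewrite diffE !big_nil subrr.
apply: (@eq_polylike _ (fun N => (a i + N%:R * b i) * \prod_(i <- s) (a i + N%:R * b i))).
  by move=> N; rewrite big_cons.
exact: polylike_affine.
Qed.

(** A polynomial function that vanishes at all positive integers vanishes at 0;
   indeed, its iterated differences at 0 are then s 0 up to sign. *)
Lemma polylike_eq0 m s : polylike m s -> (forall N, s N.+1 = 0) -> s 0 = 0.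
Proof.
elim: m s => [|m IHm] s hs s0; first exact: hs.
have d0 : diff s 0 = 0.
  by apply: IHm => [|N]; [apply/polylikeS | rewrite diffE !s0 subrr].
by move: d0; rewrite diffE s0 sub0r => /eqP; rewrite oppr_eq0 => /eqP.
Qed.

(** Removing the identity from a cut leaves only nonempty blocks, hence values at
   strictly shorter words: the operator is unipotent on words of bounded length,
   and its powers are polynomial in the exponent. *)
Lemma polylike_iter_cut z phi m w : (size w < m)%N ->
  polylike m (fun N => iter N (cut (true, z)) phi w).
Proof.
elim: m w => // m IHm [|x w] /= wm; apply/polylikeS.
  apply: (@polylikeW 0) => // N /=.
  by rewrite diffE /= cut_nil subrr.
apply: (@eq_polylike _ (fun N => z * cut_after (true, z) x
    (iter N (cut (true, z)) phi) w)).
  by move=> N; rewrite diffE /= cut_cons addrAC subrr add0r.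
apply/polylikeZ/polylike_lin => j; apply: IHm.
by rewrite size_drop (leq_ltn_trans (leq_subr _ _)).
Qed.

Lemma polylike_foldr_cut A z phi m w : (size w < m)%N ->
  polylike m (fun N => foldr cut (iter N (cut (true, z)) phi) A w).
Proof.
elim: A w => [|l A IHA] w wm; first exact: polylike_iter_cut.
apply: polylike_lin => j; apply: IHA.
by rewrite size_drop (leq_ltn_trans (leq_subr _ _)).
Qed.

(** * From ordinary to signed alphabets *)

Lemma fillings_cat A B w : fillings (A ++ B) w = foldr cut (fillings B) A w.
Proof. by rewrite /fillings foldr_cat. Qed.

Lemma fillings_nseq N l B : fillings (nseq N l ++ B) = iter N (cut l) (fillings B).
Proof. by elim: N => //= N ->. Qed.

Lemma eq_foldr_cut A phi psi : phi =1 psi -> foldr cut phi A =1 foldr cut psi A.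
Proof. by move=> /funext ->. Qed.

Lemma letter_psum_cat i A B :
  letter_psum i (A ++ B) = letter_psum i A + letter_psum i B.
Proof. by rewrite /letter_psum big_cat. Qed.

Lemma letter_psum_nseq i N l :
  letter_psum i (nseq N l) = N%:R * letter_psum i [:: l].
Proof.
rewrite /letter_psum big_seq1; elim: N => [|N IHN] /=.
  by rewrite big_nil mul0r.
by rewrite big_cons IHN -natr1 mulrDl mul1r addrC.
Qed.

Section PowerExpansion.
Variables (n : nat) (I J : finType) (P : pred I) (wd : I -> seq nat).
Variables (c : J -> rat) (sh : J -> seq nat).
Hypothesis size_wd : forall i, (size (wd i) <= n)%N.
Hypothesis size_sh : forall j, (size (sh j) <= n)%N.

Let holds ls := \sum_(i | P i) fillings ls (wd i) =
  \sum_j c j * \prod_(i <- sh j) letter_psum i ls.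

(** An expansion into power sums that holds for all ordinary alphabets extends to
   all signed ones. The induction is on the number of negative letters: in front
   of one of them, of value z, insert N ordinary letters of value -z. Both sides
   are polynomial in N. For N > 0 one inserted letter cancels the negative one, so
   that equality holds by induction; the claim is the case N = 0. *)
Lemma fillings_signed :
  (forall a : seq rat, holds [seq (true, z) | z <- a]) -> forall ls, holds ls.
Proof.
move=> h ls; elim: {ls}_.+1 {-2}ls (ltnSn (count (fun l => ~~ l.1) ls)) => // k IHk ls.
rewrite ltnS => lsk.
case: (boolP (has (fun l => ~~ l.1) ls)) => [|/hasPn pos]; last first.
  have -> : ls = [seq (true, z) | z <- [seq l.2 | l <- ls]]; last exact: h.
  rewrite -map_comp -[LHS]map_id; apply/eq_in_map => -[b z] /pos /=.
  by rewrite negbK => ->.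
move=> ls_neg; case/split_find: ls_neg lsk => -[b z] A B /= bF _.
case: b bF => // _; rewrite cat_rcons => ABk.
pose U : letter := (true, - z); pose D : letter := (false, z).
pose L N := A ++ nseq N U ++ D :: B; pose L' N := A ++ nseq N U ++ B.
(* The claim is s 0 = 0; the letters U and D cancel each other. *)
pose s N := \sum_(i | P i) fillings (L N) (wd i) -
  \sum_j c j * \prod_(i <- sh j) letter_psum i (L N).
suff : s 0 = 0 by move/eqP; rewrite subr_eq0 => /eqP.
have fillL N w : fillings (L N.+1) w = fillings (L' N) w.
  rewrite !fillings_cat !fillings_nseq iterSr; apply: eq_foldr_cut => {}w.
  by congr (iter N _ _ w); apply/funext/cutK.
have psumL N i : letter_psum i (L N.+1) = letter_psum i (L' N).
  rewrite !letter_psum_cat !letter_psum_nseq /letter_psum !big_cons !big_nil /=.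
  by rewrite -natr1; ring.
apply: (@polylike_eq0 n.+1) => [|N]; last first.
  apply/eqP; rewrite subr_eq0; apply/eqP.
  under eq_bigr do rewrite fillL; under [RHS]eq_bigr do under eq_bigr do rewrite psumL.
  apply: IHk; apply: leq_trans ABk.
  by rewrite !count_cat count_nseq /= mul0n add0n add1n addnS.
apply: (@polylikeD _ (fun N => \sum_(i | P i) fillings (L N) (wd i))
  (fun N => - \sum_j c j * \prod_(i <- sh j) letter_psum i (L N))).
  apply: (@eq_polylike _ (fun N => \sum_(i | P i) 1 * fillings (L N) (wd i))).
    by move=> N; apply: eq_bigr => i _; rewrite mul1r.
  apply: polylike_lin => i.
  apply: (@eq_polylike _ (fun N => foldr cut (iter N (cut U) (fillings (D :: B))) A (wd i))).
    by move=> N; rewrite fillings_cat fillings_nseq.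
  by apply: polylike_foldr_cut; rewrite ltnS.
apply: (@eq_polylike _ (fun N => -1 * \sum_j c j * \prod_(i <- sh j) letter_psum i (L N))).
  by move=> N; rewrite mulN1r.
apply/polylikeZ/polylike_lin => j.
apply: (@polylikeW (size (sh j)).+1); first by rewrite ltnS.
apply: (@eq_polylike _ (fun N => \prod_(i <- sh j)
    ((letter_psum i A + letter_psum i (D :: B)) + N%:R * letter_psum i [:: U]))).
  move=> N; apply: eq_bigr => i _.
  by rewrite !letter_psum_cat letter_psum_nseq; ring.
exact: polylike_prod.
Qed.

End PowerExpansion.

(** * Compatible sequences *)

(** With this order, the compatibility of s with w becomes sortedness of the
   sequence of pairs (s_i, w_i), see [compatibleE]. *)
Definition lexle (p q : nat * nat) : bool :=
  (p.1 < q.1)%N || (p.1 == q.1) && (p.2 <= q.2)%N.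

Lemma lexle_trans : transitive lexle.
Proof. by move=> [a b] [c d] [e f]; rewrite /lexle /=; lia. Qed.

Lemma lexle_anti : antisymmetric lexle.
Proof.
move=> [a b] [c d]; rewrite /lexle /= => h.
by have [-> ->] : a = c /\ b = d by lia.
Qed.

Lemma lexle_total : total lexle.
Proof. by move=> [a b] [c d]; rewrite /lexle /=; lia. Qed.

Lemma compatibleE w s :
  compatible w s = (size s == size w) && sorted lexle (zip s w).
Proof.
rewrite /compatible; case: eqP => //= szs.
have szz : size (zip s w) = size w by rewrite size_zip szs minnn.
apply/andP/(sortedP (0, 0)%N) => [[/(sortedP 0%N) ss /allP ds] i|h].
  rewrite szz => iw; rewrite !nth_zip // /lexle /=.
  have := ss i; rewrite szs => /(_ iw); rewrite leq_eqVlt => /orP[e|->//].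
  rewrite e /=; apply/orP; right; rewrite leqNgt; apply/negP => d.
  have := ds i; rewrite mem_iota /= add0n (ltnW iw) /is_descent iw d => /(_ isT).
  by rewrite /= (eqP e) ltnn.
have {}h i : (i.+1 < size w)%N ->
    (nth 0 s i < nth 0 s i.+1)%N ||
    (nth 0%N s i == nth 0%N s i.+1) && (nth 0 w i <= nth 0 w i.+1)%N.
  by move=> iw; have := h i; rewrite szz !nth_zip // => /(_ iw).
split; first by apply/(sortedP 0%N) => i; rewrite szs => /h; lia.
by apply/allP => i _; apply/implyP => /andP[/h]; lia.
Qed.

(** The weakly increasing sequences of length n with entries in [lo, lo + r),
   enumerated by the multiplicity of lo, so that they unfold like [fillings]. *)
Fixpoint wseqs (lo r n : nat) : seq (seq nat) :=
  if r is r'.+1 then [seq nseq j lo ++ s | j <- iota 0 n.+1, s <- wseqs lo.+1 r' (n - j)]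
  else if n is 0 then [:: [::]] else [::].

Lemma sorted_leq_split lo s : sorted leq s -> all (leq lo) s ->
  s = nseq (count_mem lo s) lo ++ [seq i <- s | i != lo].
Proof.
elim: s => //= x s IHs xs /andP[lox los].
case: (eqVneq x lo) => [->|xlo] /=.
  by rewrite add0n -IHs // (path_sorted xs).
have s_gt i : i \in s -> i != lo.
  move=> si; have := allP (order_path_min leq_trans xs) _ si.
  by move: xlo lox; rewrite /=; lia.
rewrite (_ : count_mem lo s = 0)%N /=.
  by congr (_ :: _); rewrite -[LHS]filter_predT; apply: eq_in_filter => i /s_gt ->.
by apply/count_memPn/negP => /s_gt; rewrite eqxx.
Qed.

Lemma mem_wseqs lo r n s : (s \in wseqs lo r n) =
  [&& size s == n, sorted leq s & all (fun i => lo <= i < lo + r)%N s].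
Proof.
elim: r lo n s => [|r IHr] lo n s.
  case: s => [|x s]; first by case: n.
  have -> : all (fun i => lo <= i < lo + 0)%N (x :: s) = false.
    by apply/negbTE/negP => /= /andP[]; lia.
  by rewrite !andbF; case: n.
apply/allpairsPdep/and3P => [[j [s' []]]|[/eqP szs ss /allP s_lo]].
  rewrite mem_iota /= add0n ltnS IHr => jn /and3P[/eqP szs' ss' /allP s'lo] ->.
  have [p1 p2] : all (leq lo) s' /\ all (fun i => lo <= i < lo + r.+1)%N s'.
    by split; apply/allP => i /s'lo /=; lia.
  split; first by rewrite size_cat size_nseq szs' subnKC.
    rewrite (sorted_pairwise leq_trans) pairwise_cat -!(sorted_pairwise leq_trans) ss' andbT.
    apply/andP; split; last first.
      by apply/(sortedP 0%N) => i; rewrite size_nseq => h; rewrite !nth_nseq h (ltnW h).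
    by apply/allrelP => x y; rewrite mem_nseq => /andP[_ /eqP->]; apply/allP.
  rewrite all_cat p2 andbT; apply/allP => i; rewrite mem_nseq => /andP[_ /eqP->].
  by lia.
have lo_s : all (leq lo) s by apply/allP => i /s_lo /andP[].
have sE := sorted_leq_split ss lo_s.
exists (count_mem lo s), [seq i <- s | i != lo]; split=> //.
  by rewrite mem_iota /= add0n ltnS -szs count_size.
rewrite IHr; apply/and3P; split.
- by rewrite size_filter -szs -(count_predC (pred1 lo) s) addKn.
- exact: sorted_filter leq_trans _ _ ss.
apply/allP => i; rewrite mem_filter => /andP[ilo /s_lo].
by move: ilo; lia.
Qed.

Lemma wseqs_uniq lo r n : uniq (wseqs lo r n).
Proof.
elim: r lo n => [|r IHr] lo n; first by case: n.
apply: allpairs_uniq_dep => [|j _|]; rewrite ?iota_uniq //.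
have no_lo s m : s \in wseqs lo.+1 r m -> count_mem lo s = 0%N.
  rewrite mem_wseqs => /and3P[_ _ /allP h].
  by apply/count_memPn/negP => /h; rewrite ltnn.
move=> [j s] [j' s'] /allpairsPdep[x [y [_ sy [? ?]]]].
case/allpairsPdep=> [x' [y' [_ sy' [? ?]]]] /= e; subst x y x' y'.
have := congr1 (count_mem lo) e; rewrite !count_cat !count_nseq /= eqxx !mul1n.
rewrite (no_lo _ _ sy) (no_lo _ _ sy') !addn0 => jE.
by move: e; rewrite jE => /eqP; rewrite eqseq_cat // eqxx => /eqP ->.
Qed.

Lemma wseqsS lo r n : wseqs lo r.+1 n =
  [seq nseq j lo ++ s | j <- iota 0 n.+1, s <- wseqs lo.+1 r (n - j)].
Proof. by []. Qed.

Lemma compatible_nseq_cat lo j s w : (j <= size w)%N ->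
  size s = (size w - j)%N -> all (ltn lo) s ->
  compatible w (nseq j lo ++ s) = block true (take j w) && compatible (drop j w) s.
Proof.
move=> jw szs lo_s; rewrite !compatibleE size_cat size_nseq size_drop szs.
rewrite subnKC // !eqxx /= -{1}(cat_take_drop j w) zip_cat; last first.
  by rewrite size_nseq size_takel.
rewrite (sorted_pairwise lexle_trans) pairwise_cat -!(sorted_pairwise lexle_trans).
rewrite (_ : allrel _ _ _ = true) /=; last first.
  apply/allrelP => -[a b] [c d] /(map_f fst); rewrite -/unzip1 unzip1_zip; last first.
    by rewrite size_nseq size_takel.
  rewrite mem_nseq => /andP[_ /eqP /= ->] /(map_f fst).
  rewrite -/unzip1 unzip1_zip ?size_drop ?szs //.
  by move=> /(allP lo_s) /= lo_c; rewrite /lexle /= lo_c.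
congr (_ && _); rewrite /block; move: (take j w) (size_takel jw) => u <- {jw szs}.
elim: u => //= x [|y u] IHu //=; congr (_ && _); last exact: IHu.
by rewrite /lexle /= ltnn eqxx.
Qed.

Lemma sum_compatible (F : nat -> rat) lo r w :
  \sum_(s <- wseqs lo r (size w)) (compatible w s)%:R * \prod_(i <- s) F i =
  fillings [seq (true, F i) | i <- iota lo r] w.
Proof.
elim: r lo w => [|r IHr] lo w.
  by case: w => [|x w] /=; rewrite ?big_nil // big_seq1 big_nil mulr1.
rewrite wseqsS big_allpairs_dep.
rewrite -[RHS]/(cut (true, F lo) (fillings [seq (true, F i) | i <- iota lo.+1 r]) w).
rewrite [RHS]/cut.
rewrite -[iota 0 _]/(index_iota 0 (size w).+1) big_mkord.
apply: eq_bigr => j _; rewrite -IHr size_drop mulr_sumr.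
apply: eq_big_seq => s; rewrite mem_wseqs => /and3P[/eqP szs _ /allP lo_s].
rewrite compatible_nseq_cat ?leq_ord ?szs //; last by apply/allP => i /lo_s /andP[].
by rewrite big_cat big_nseq iter_mulr_1 -mulnb natrM -!mulrA; congr (_ * _); rewrite mulrCA.
Qed.

(** * Specialization at finitely many variables *)

Section Specialization.
Local Open Scope mset_scope.
Local Open Scope ring_scope.

Definition monomials (r n : nat) : seq {mset nat} :=
  [seq seq_mset s | s <- wseqs 0 r n].

Lemma mem_monomials r n (m : {mset nat}) :
  (m \in monomials r n) = (size m == n) && all (fun i => i < r)%N m.
Proof.
apply/mapP/andP => [[s]|[szm m_r]].
  rewrite mem_wseqs => /and3P[szs _ s_r] ->.
  rewrite (perm_size (perm_eq_seq_mset s)) szs; split=> //.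
  by rewrite (perm_all _ (perm_eq_seq_mset s)).
exists (sort leq m).
  rewrite mem_wseqs size_sort szm (sort_sorted leq_total) /=.
  by rewrite (perm_all _ (permEl (perm_sort leq m))).
rewrite -[LHS]seq_mset_id; apply/eq_seq_msetP.
by rewrite perm_sym (permPl (permEl (perm_sort leq m))).
Qed.

Lemma monomials_uniq r n : uniq (monomials r n).
Proof.
rewrite map_inj_in_uniq ?wseqs_uniq // => s t.
rewrite !mem_wseqs => /and3P[_ ss _] /and3P[_ st _] /eq_seq_msetP.
exact: sorted_eq leq_trans anti_leq _ _ ss st.
Qed.

Definition monomial_value (a : seq rat) (m : {mset nat}) : rat :=
  \prod_(i <- (m : seq nat)) a`_i.

Lemma monomial_valueD a (A B : {mset nat}) :
  monomial_value a (A + B) = monomial_value a A * monomial_value a B.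
Proof. by rewrite /monomial_value (perm_big _ (perm_msetD A B)) big_cat. Qed.

(** The ring homomorphism x_j |-> a_j t, with x_j |-> 0 beyond the length of a. The
   variable t records the degree, which makes every coefficient a finite sum. *)
Definition spec (a : seq rat) (f : xseries) : series nat := fun n =>
  \sum_(m <- monomials (size a) n) f m * monomial_value a m.

Lemma specM a f g : spec a (f * g) = spec a f * spec a g.
Proof.
apply/seriesP => n; rewrite coef_seriesM /spec.
pose r := size a.
pose T (p : {mset nat} * {mset nat}) :=
  f p.1 * monomial_value a p.1 * (g p.2 * monomial_value a p.2).
pose s1 := [seq p | m <- monomials r n, p <- decomp m].
pose s2 := [seq p | q <- decomp n,
  p <- [seq (A, B) | A <- monomials r q.1, B <- monomials r q.2]].
transitivity (\sum_(p <- s1) T p).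
  rewrite big_allpairs_dep; apply: eq_bigr => m _.
  rewrite coef_seriesM mulr_suml; apply: eq_big_seq => -[A B].
  by rewrite mem_decomp /= => /eqP <-; rewrite monomial_valueD mulrACA.
transitivity (\sum_(p <- s2) T p); last first.
  rewrite big_allpairs_dep; apply: eq_bigr => q _; rewrite big_allpairs mulr_suml.
  by apply: eq_bigr => A _; rewrite mulr_sumr.
have ms1 A B : ((A, B) \in s1) = (A + B \in monomials r n).
  apply/allpairsPdep/idP => [[m [p [mn + pE]]]|ABn].
    by rewrite -pE mem_decomp => /eqP ->.
  by exists (A + B), (A, B); rewrite mem_decomp.
have allD (A B : {mset nat}) : all (fun i => i < r)%N (A + B : {mset nat}) =
    all (fun i => i < r)%N A && all (fun i => i < r)%N B.
  by rewrite (perm_all _ (perm_msetD A B)) all_cat.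
apply/perm_big/uniq_perm.
- apply: allpairs_uniq_dep => [|m _|]; rewrite ?monomials_uniq ?decomp_uniq //.
  move=> [m p] [m' p'] /allpairsPdep[x [y [_ + [? ?]]]].
  move=> + /allpairsPdep[x' [y' [_ + [? ?]]]]; subst.
  by rewrite !mem_decomp => /eqP <- /eqP <- /= ->.
- apply: allpairs_uniq_dep => [|q _|]; rewrite ?decomp_uniq //.
    by apply: allpairs_uniq; rewrite ?monomials_uniq // => -[? ?] [? ?] _ _ /= [-> ->].
  move=> [[i j] p] [[i' j'] p'] /allpairsPdep[x [y [_ + [? ?]]]].
  move=> + /allpairsPdep[x' [y' [_ + [? ?]]]]; subst => /=.
  move=> /allpairsP[[A B] /= [+ + ->]] /allpairsP[[A' B'] /= [+ + ->]] [? ?]; subst.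
  by rewrite !mem_monomials => /andP[/eqP<- _] /andP[/eqP<- _] /andP[/eqP<- _] /andP[/eqP<- _].
move=> [A B]; rewrite ms1 mem_monomials size_msetD allD.
apply/andP/allpairsPdep => [[ABn /andP[Ar Br]]|].
  exists (size (A : {mset nat}), size (B : {mset nat})), (A, B).
  split=> //; first by rewrite mem_decomp.
  by apply/allpairsP; exists (A, B); rewrite !mem_monomials !eqxx Ar Br.
move=> [[i j] [p [+ + pE]]]; rewrite mem_decomp /= => /eqP <-.
move=> /allpairsP[[A' B'] /= []]; rewrite -pE => + + [-> ->].
by rewrite !mem_monomials => /andP[/eqP-> ->] /andP[/eqP-> ->].
Qed.

Lemma spec1 a : spec a 1 = 1.
Proof.
apply/seriesP => n; rewrite coef_series1 /spec.
transitivity (\sum_(m <- monomials (size a) n | m == 0) 1 : rat).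
  rewrite [RHS]big_mkcond; apply: eq_bigr => m _; rewrite coef_series1.
  case: eqP => [->|]; last by rewrite mul0r.
  by rewrite /monomial_value -[0]/(@mset0 nat) enum_mset0 big_nil mulr1.
rewrite -big_filter.
have [->|n0] := eqVneq n 0.
  rewrite filter_pred1_uniq ?monomials_uniq ?big_seq1 //.
  by rewrite mem_monomials -[0]/(@mset0 nat) size_mset0 enum_mset0.
rewrite big_filter big_seq_cond big1 // => m /andP[+ /eqP mE].
by rewrite mem_monomials mE -[0]/(@mset0 nat) size_mset0 eq_sym (negbTE n0).
Qed.

Lemma spec_psum a i : (0 < i)%N ->
  spec a (psum_series i) = (\sum_(z <- a) z ^+ i) *: 't ^+ i.
Proof.
move=> i0; apply/seriesP => n; rewrite coef_seriesZ /spec.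
have -> : 't ^+ i = horner_alg 't 'X^i by rewrite rmorphXn /= horner_algX.
rewrite coef_fps_poly coefXn.
rewrite (eq_bigr (fun m =>
    if `[< exists j, m = msetn i j >] then monomial_value a m else 0)); last first.
  by move=> m _; rewrite /psum_series; case: ifP; rewrite ?mul1r ?mul0r.
rewrite -big_mkcond -big_filter.
have inj : injective (fun j => msetn i j : {mset nat}).
  move=> j k e; have : j \in msetn i k by rewrite -e in_msetn i0 eqxx.
  by rewrite in_msetn => /andP[_ /eqP].
have [->|ni] := eqVneq n i; last first.
  rewrite mulr0 big_filter big_seq_cond big1 // => m /andP[+ /asboolP[j mE]].
  by rewrite mem_monomials mE enum_msetn size_nseq eq_sym (negbTE ni).
rewrite mulr1 (perm_big [seq msetn i j | j <- iota 0 (size a)]).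
  rewrite big_map -[in RHS](mkseq_nth 0 a) big_map; apply: eq_bigr => j _.
  by rewrite /monomial_value enum_msetn big_nseq iter_mulr_1.
apply: uniq_perm.
- by rewrite filter_uniq ?monomials_uniq.
- by rewrite map_inj_uniq ?iota_uniq.
move=> m; rewrite mem_filter mem_monomials; apply/idP/mapP.
  case/andP=> /asboolP[j ->]; rewrite enum_msetn => /andP[_].
  by rewrite all_nseq eqn0Ngt i0 /= => ja; exists j => //; rewrite mem_iota.
move=> [j + ->]; rewrite mem_iota /= enum_msetn size_nseq eqxx all_nseq => ->.
by rewrite orbT !andbT; apply/asboolP; exists j.
Qed.

Lemma spec_sum a I (r : seq I) (P : pred I) (F : I -> xseries) :
  spec a (\sum_(i <- r | P i) F i) = \sum_(i <- r | P i) spec a (F i).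
Proof.
apply/seriesP => n; rewrite coef_series_sum exchange_big /spec.
by apply: eq_bigr => m _; rewrite coef_series_sum mulr_suml.
Qed.

Lemma specZ a (k : rat) f : spec a (k *: f) = k *: spec a f.
Proof.
apply/seriesP => n; rewrite coef_seriesZ mulr_sumr.
by apply: eq_bigr => m _; rewrite coef_seriesZ mulrA.
Qed.

Lemma spec_prod_psum a s : 0%N \notin s ->
  spec a (\prod_(i <- s) psum_series i) =
  (\prod_(i <- s) \sum_(z <- a) z ^+ i) *: 't ^+ sumn s.
Proof.
elim: s => [|i s IHs]; first by rewrite !big_nil spec1 expr0 scale1r.
rewrite inE negb_or eq_sym -lt0n => /andP[i0 /IHs e].
by rewrite !big_cons specM e spec_psum // -scalerAl -scalerAr scalerA exprD.
Qed.

Lemma Fquasi_seq_mset w s : sorted leq s -> Fquasi w (seq_mset s) = (compatible w s)%:R.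
Proof.
move=> ss; rewrite /Fquasi.
have ps : s \in permutations (seq_mset s).
  by rewrite mem_permutations perm_sym perm_eq_seq_mset.
rewrite (eq_in_count (a2 := fun t => (t == s) && compatible w s)) => [|t].
  case: (compatible w s); last first.
    by rewrite (@eq_count _ _ pred0) ?count_pred0 // => t; rewrite /= andbF.
  rewrite (@eq_count _ _ (pred1 s)) => [|t]; last by rewrite /= andbT.
  by rewrite count_uniq_mem ?permutations_uniq // ps.
rewrite mem_permutations (permPr (perm_eq_seq_mset s)) => ts.
case: eqVneq => [->|/eqP neq] //=; apply/negP => /and3P[_ st _].
by apply: neq; apply: (sorted_eq leq_trans anti_leq).
Qed.

Lemma spec_Fquasi a w : spec a (Fquasi w) (size w) = fillings [seq (true, z) | z <- a] w.
Proof.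
rewrite /spec big_map -[in RHS](mkseq_nth 0 a) -map_comp -sum_compatible.
apply: eq_big_seq => s; rewrite mem_wseqs => /and3P[_ ss _].
rewrite Fquasi_seq_mset //; congr (_ * _).
by apply: perm_big; apply: perm_eq_seq_mset.
Qed.

End Specialization.

(** * The power sum expansion of fillings *)

Lemma parts_gt0 n (l : intpart n) i : i \in parts l -> (0 < i)%N.
Proof.
move=> il; rewrite lt0n; apply: contraTneq il => ->.
by have /and3P[] := intpart_valP l.
Qed.

Lemma sumn_parts n (l : intpart n) : sumn l = n.
Proof. by have /and3P[_ _ /eqP] := intpart_valP l. Qed.

Lemma size_parts n (l : intpart n) : (size l <= n)%N.
Proof. by rewrite size_map size_bseq. Qed.

Lemma size_parts_gt0 n (l : intpart n) : (0 < n)%N -> (0 < size l)%N.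
Proof. by rewrite -[in (0 < n)%N](sumn_parts l); case: (parts l). Qed.

Lemma size_word n (pi : 'S_n) : size (word pi) = n.
Proof. by rewrite size_image card_ord. Qed.

Lemma symfun_val_psum_poly n (c : intpart n -> rat) :
  symfun_val (psum_poly c psum) =
  \sum_(l : intpart n) c l *: \prod_(i <- parts l) psum_series i.
Proof.
transitivity (\sum_(l : intpart n) symfun_val (c l *: \prod_(i <- parts l) psum i)).
  exact: (raddf_sum (val : symfun -> xseries)).
apply: eq_bigr => l _; congr (_ *: _).
exact: (rmorph_prod (val : symfun -> xseries)).
Qed.

(** For symmetric Q(Pi), evaluating the F_pi on a signed alphabet is a homomorphism
   on power sums. On ordinary alphabets this is the degree n part of [spec]. *)
Theorem sum_fillings n (Pi : {set 'S_n}) (c : intpart n -> rat) :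
  symfun_val (psum_poly c psum) = Qgf Pi ->
  forall ls, \sum_(pi in Pi) fillings ls (word pi) =
    \sum_(l : intpart n) c l * \prod_(i <- parts l) letter_psum i ls.
Proof.
move=> QE; apply: (@fillings_signed n) => [pi|l|a].
- by rewrite size_word.
- exact: size_parts.
have := congr1 (fun f => spec a f n) QE; rewrite symfun_val_psum_poly /Qgf.
rewrite !spec_sum !coef_series_sum => e.
transitivity (\sum_(pi in Pi) spec a (Fquasi (word pi)) n).
  by apply: eq_bigr => pi _; rewrite -spec_Fquasi size_word.
rewrite -e; apply: eq_bigr => l _.
rewrite specZ coef_seriesZ spec_prod_psum; last by apply/negP => /parts_gt0.
have -> : 't ^+ sumn l = horner_alg 't 'X^(sumn l) by rewrite rmorphXn /= horner_algX.
rewrite coef_seriesZ coef_fps_poly coefXn sumn_parts eqxx mulr1.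
congr (_ * _); apply: eq_bigr => i _.
by rewrite /letter_psum big_map; apply: eq_bigr.
Qed.

Lemma Theta1_lin k I (r : seq I) (c : I -> rat) (sh : I -> seq nat) (g : nat -> symfun) :
  Theta1 k (\sum_(l <- r) c l *: \prod_(i <- sh l) g i) =
  \sum_(l <- r) c l * \prod_(i <- sh l) Theta1 k (g i).
Proof.
rewrite /Theta1 /plethysm raddf_sum horner_sum; apply: eq_bigr => l _.
by rewrite /= linearZ hornerZ rmorph_prod horner_prod.
Qed.

Lemma Theta1_1 k : Theta1 k 1 = 1.
Proof. by rewrite /Theta1 /plethysm rmorph1 hornerC. Qed.

Lemma Theta1D k f g : Theta1 k (f + g) = Theta1 k f + Theta1 k g.
Proof. by rewrite /Theta1 /plethysm raddfD hornerD. Qed.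


Lemma plethysm_X1_lin I (r : seq I) (c : I -> rat) (sh : I -> seq nat) (g : nat -> symfun) :
  plethysm_X1 (\sum_(l <- r) c l *: \prod_(i <- sh l) g i) =
  \sum_(l <- r) c l *: \prod_(i <- sh l) plethysm_X1 (g i).
Proof.
rewrite /plethysm_X1 raddf_sum; apply: eq_bigr => l _.
by rewrite /= linearZ rmorph_prod.
Qed.

Lemma plethysm_X1_psum i : (0 < i)%N -> plethysm_X1 (psum i) = psum i + 1.
Proof. exact: psum_hom_psum. Qed.

Lemma Theta1_psum_poly (k : nat) n (c : intpart n -> rat) :
  Theta1 k (psum_poly c psum) =
  \sum_(l : intpart n) c l * \prod_(i <- parts l) (k%:R * (1 - (-1) ^+ i)).
Proof.
rewrite Theta1_lin; apply: eq_bigr => l _; congr (_ * _).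
by apply: eq_big_seq => i /parts_gt0 i0; rewrite Theta1_psum.
Qed.

Lemma Theta1_plethysm_X1 (k : nat) n (c : intpart n -> rat) :
  Theta1 k (plethysm_X1 (psum_poly c psum)) =
  \sum_(l : intpart n) c l * \prod_(i <- parts l) (k%:R * (1 - (-1) ^+ i) + 1).
Proof.
rewrite plethysm_X1_lin Theta1_lin; apply: eq_bigr => l _; congr (_ * _).
apply: eq_big_seq => i /parts_gt0 i0.
by rewrite plethysm_X1_psum // Theta1D Theta1_1 Theta1_psum.
Qed.

(** * Generating functions of fillings *)

(** The letters have value 1 and signs b, nx b, nx (nx b), ...: alternating signs
   lead to up-down runs ([nx = negb]), a constant sign to descents ([nx = id]). *)
Definition filling_gf (nx : bool -> bool) (b : bool) (w : seq nat) : series nat :=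
  fun r => fillings [seq (b', 1) | b' <- traject nx b r] w.

Lemma filling_gf_nil nx b : (1 - 't) * filling_gf nx b [::] = 1.
Proof.
have g1 r : filling_gf nx b [::] r = 1.
  by rewrite /filling_gf; elim: r b => //= r IHr b; rewrite cut_nil IHr.
apply/seriesP => -[|r]; rewrite mulrBl mul1r coef_seriesD coef_seriesN coef_fpsTM coef_series1.
  by rewrite g1 subr0.
by rewrite !g1 subrr.
Qed.

Lemma filling_gf1 nx b x : filling_gf nx b [:: x] =
  't * (filling_gf nx (nx b) [:: x] + filling_gf nx (nx b) [::]).
Proof.
apply/seriesP => -[|r]; rewrite coef_fpsTM // /filling_gf /= cut_cons mul1r.
by rewrite cut_after_nil.
Qed.

(** Either the first block is empty, or x can be removed from it. If the step from x
   to y is not allowed in this block, x is alone in it and the block is removed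
   with x. *)
Lemma filling_gf_cons nx b x y w : filling_gf nx b (x :: y :: w) =
  't * filling_gf nx (nx b) (x :: y :: w) +
  (if step b x y then filling_gf nx b (y :: w)
   else 't * filling_gf nx (nx b) (y :: w)).
Proof.
apply/seriesP => -[|r]; rewrite coef_seriesD coef_fpsTM /filling_gf /=.
  by case: ifP; rewrite ?coef_fpsTM addr0.
rewrite cut_cons mul1r cut_after_cons; congr (_ + _).
by case: ifP => // _; rewrite coef_fpsTM.
Qed.

(** The number of changes in the sequence of directions of x w, to which b is
   prefixed as the direction in which x was reached. *)
Definition turns (b : bool) (x : nat) (w : seq nat) : nat :=
  count id (pairmap addb b (pairmap leq x w)).

Lemma fps_unit1Dt (f : series nat) k : 1 + 't ^+ k.+1 * f \is a GRing.unit.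
Proof.
by rewrite fps_unitE coef_seriesD exprS -mulrA coef_fpsTM coef_series1 addr0 oner_eq0.
Qed.

(** Let d be the direction of the step from x to y. The recurrences for the two
   possible first signs form a linear system that expresses both series through
   the series of y w with first sign d: the factor is (1+t^2)/(1-t^2) for the first
   sign d and q times as much for the other sign. *)
Lemma filling_gf_turns (q : series nat) b x w : (1 + 't ^+ 2) * q = 2%:R * 't ->
  (1 - 't) ^+ 2 * (1 - 't ^+ 2) ^+ size w * filling_gf negb b (x :: w) =
  't * (1 + 't ^+ 2) ^+ size w * q ^+ turns b x w.
Proof.
move=> qE; elim: w b x => [|y w IHw] b x.
  rewrite /turns /= !expr0 !mulr1.
  (* The linear system has determinant 1 - t^2, one factor of which is superfluous
     for a single letter. *)
  have uD : 1 + 't \is a GRing.unit by have := fps_unit1Dt 1 0; rewrite expr1 mulr1.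
  apply: (mulrI uD).
  have e1 := filling_gf1 negb b x; have e2 := filling_gf1 negb (~~ b) x.
  rewrite negbK in e2; move: e1 e2 (filling_gf_nil negb b) (filling_gf_nil negb (~~ b)).
  set g := filling_gf _ b [:: x]; set g' := filling_gf _ (~~ b) [:: x].
  set h := filling_gf _ b _; set h' := filling_gf _ (~~ b) _ => e1 e2 hE h'E.
  transitivity ((1 - 't) * ((1 - 't ^+ 2) * g)); first by ring.
  have -> : (1 - 't ^+ 2) * g = 't ^+ 2 * h + 't * h'.
    by rewrite mulrBl mul1r {1}e1 e2; ring.
  transitivity ('t ^+ 2 * ((1 - 't) * h) + 't * ((1 - 't) * h')); first by ring.
  by rewrite hE h'E; ring.
pose d := (x <= y)%N.
have stepE b' : step b' x y = (b' == d).
  by rewrite /d; case: b' => /=; rewrite /gtn /= ?ltnNge; case: (x <= y)%N.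
have e1 : filling_gf negb d (x :: y :: w) =
    't * filling_gf negb (~~ d) (x :: y :: w) + filling_gf negb d (y :: w).
  by rewrite filling_gf_cons stepE eqxx.
have e2 : filling_gf negb (~~ d) (x :: y :: w) =
    't * filling_gf negb d (x :: y :: w) + 't * filling_gf negb d (y :: w).
  by rewrite filling_gf_cons negbK stepE; case: (d).
have e : (1 - 't ^+ 2) * filling_gf negb b (x :: y :: w) =
    (1 + 't ^+ 2) * q ^+ (b (+) d) * filling_gf negb d (y :: w).
  have [->|] := eqVneq b d.
    rewrite addbb expr0 mulr1 mulrBl mul1r {1}e1 e2; ring.
  move=> bd; have -> : b = ~~ d by move: bd; case: (b) (d) => -[].
  rewrite addbC addbN addbb expr1 qE mulrBl mul1r {1}e2 e1; ring.
have -> : turns b x (y :: w) = ((b (+) d) + turns d y w)%N by [].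
transitivity ((1 - 't) ^+ 2 * (1 - 't ^+ 2) ^+ size w *
    ((1 - 't ^+ 2) * filling_gf negb b (x :: y :: w))).
  by rewrite /= [_ ^+ (size w).+1]exprS; ring.
rewrite e /= exprD [_ ^+ (size w).+1]exprS.
transitivity ((1 + 't ^+ 2) * q ^+ (b (+) d) * ((1 - 't) ^+ 2 * (1 - 't ^+ 2) ^+ size w *
    filling_gf negb d (y :: w))); first by ring.
by rewrite IHw; ring.
Qed.

Lemma des_cons x y w : des (x :: y :: w) = ((y < x) + des (y :: w))%N.
Proof.
rewrite /des -[size (x :: y :: w)]/(1 + (size w).+1)%N iotaD count_cat.
by rewrite (iotaDl 1 0) count_map [X in (X + _)%N]/= addn0.
Qed.

(** Each letter, and the end of the word, contributes a factor 1/(1-t) for the empty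
   blocks in front of it, and each descent forces a new block. *)
Lemma filling_gf_des x w :
  (1 - 't) ^+ (size w).+2 * filling_gf id true (x :: w) = 't ^+ (des (x :: w)).+1.
Proof.
elim: w x => [|y w IHw] x.
  have := filling_gf1 id true x; have := filling_gf_nil id true.
  set g := filling_gf _ _ [:: x]; set h := filling_gf _ _ _ => hE gE.
  have e : (1 - 't) * g = 't * h by rewrite mulrBl mul1r {1}gE; ring.
  rewrite exprS expr1 -mulrA e mulrCA hE mulr1.
  by rewrite /des /= /is_descent /= expr1.
have := filling_gf_cons id true x y w.
set g := filling_gf _ _ (x :: _); set h := filling_gf _ _ (y :: _) => gE.
rewrite des_cons exprS -mulrA.
transitivity ((1 - 't) ^+ (size w).+2 * ((1 - 't) * g)); first by rewrite /=; ring.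
have -> : (1 - 't) * g = 't ^+ (y < x)%N * h.
  rewrite mulrBl mul1r {1}gE /step ltnNge.
  by case: leqP => _; rewrite ?expr0 ?expr1 ?mul1r; ring.
by rewrite mulrCA IHw -exprD addnS.
Qed.

(** * Up-down runs and changes of direction *)

Section Biruns.
Variable w : seq nat.
Hypothesis w_uniq : uniq w.

Let n := size w.
Let asc (k : nat) : bool := (nth 0%N w k <= nth 0%N w k.+1)%N.

Lemma monotone_factorP i j : (i <= j < n)%N ->
  reflect (forall k, (i <= k < j)%N -> asc k = asc i) (monotone (factor w (i, j))).
Proof.
move=> /andP[ij jn].
have szF : size (factor w (i, j)) = (j.+1 - i)%N by rewrite size_drop size_takel.
have nthF k : (i + k <= j)%N -> nth 0%N (factor w (i, j)) k = nth 0%N w (i + k).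
  by move=> ikj; rewrite /factor nth_drop nth_take.
have sortedE e : sorted e (factor w (i, j)) <->
    (forall k, (i <= k < j)%N -> e (nth 0%N w k) (nth 0%N w k.+1)).
  split=> [/(sortedP 0%N) + k kij|h].
    move=> /(_ (k - i)%N); rewrite szF !nthF; [|lia..].
    have -> : (i + (k - i).+1 = k.+1)%N by lia.
    have -> : (i + (k - i) = k)%N by lia.
    by apply; lia.
  apply/(sortedP 0%N) => k; rewrite szF => kj.
  rewrite !nthF; [|lia..].
  by rewrite addnS; apply: h; lia.
have neq k : (i <= k < j)%N -> nth 0%N w k != nth 0%N w k.+1.
  by move=> kij; rewrite nth_uniq //; rewrite -/n; lia.
apply: (iffP orP) => [[] /sortedE h k kij|h].
- have iij : (i <= i < j)%N by lia.
  by rewrite /asc (ltnW (h _ kij)) (ltnW (h _ iij)).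
- have iij : (i <= i < j)%N by lia.
  by rewrite /asc (ltn_geF (h _ kij)) (ltn_geF (h _ iij)).
case: (boolP (asc i)) => ai; [left|right]; apply/sortedE => k kij.
  by move: (neq k kij) (h k kij); rewrite ai /asc /=; lia.
by move: (neq k kij) (h k kij); rewrite (negbTE ai) /asc /=; lia.
Qed.

Lemma mem_factors p : (p \in factors w) = (p.1 <= p.2 < n)%N.
Proof.
case: p => i j; apply/allpairsPdep/idP => [[i' [j' [+ + [-> ->]]]]|/= ij].
  by rewrite !mem_iota /=; lia.
by exists i, j; rewrite !mem_iota; split=> //; lia.
Qed.

Lemma factors_uniq : uniq (factors w).
Proof.
apply: allpairs_uniq_dep => [|i _|]; rewrite ?iota_uniq //.
by move=> [i j] [i' j'] _ _ /= [-> ->].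
Qed.

Lemma birunP i j : (i <= j < n)%N ->
  reflect (monotone (factor w (i, j)) /\ forall i' j', (i' <= i)%N -> (j <= j' < n)%N ->
     monotone (factor w (i', j')) -> i' = i /\ j' = j) (is_birun w (i, j)).
Proof.
move=> ij; apply: (iffP andP) => [[m /allP h]|[m h]]; split=> //.
  move=> i' j' i'i j'j mm; have := h (i', j'); rewrite mem_factors /=.
  have -> : (i' <= j' < n)%N by lia.
  rewrite i'i mm andbT; have -> : (j <= j')%N by lia.
  by move=> /(_ isT) /eqP[-> ->].
apply/allP => -[i' j']; rewrite mem_factors /= => ij'; apply/implyP => /and3P[i'i jj' mm].
by have [|//|-> ->] := h i' j' i'i; first lia.
Qed.

(** In a word of length at least 2, the position 0 and the interior peaks and
   valleys. *)
Definition birun_start (i : nat) : bool :=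
  (i.+1 < n)%N && ((i == 0)%N || (asc i.-1 != asc i)).

(** From a start, the only birun is the longest monotone factor. From any other
   position i, a monotone factor extends to the left by one letter. *)
Lemma count_birun_from i : (1 < n)%N -> (i < n)%N ->
  count (fun j => is_birun w (i, j)) (iota i (n - i)) = birun_start i.
Proof.
move=> n1 i_n; case: (boolP (birun_start i)); rewrite /birun_start => st; last first.
  rewrite (@eq_in_count _ _ pred0) ?count_pred0 // => j; rewrite mem_iota => ij.
  apply/negP => /birunP[|/monotone_factorP m h]; first lia.
  have i_gt0 : (0 < i)%N by move: st; lia.
  have [|||] := h i.-1 j; [lia..| |lia].
  apply/monotone_factorP => [|k kij]; first lia.
  have [->//|ki] := eqVneq k i.-1.
  rewrite m; [|lia|lia]; move: st; rewrite negb_and negb_or negbK.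
  by case/orP=> [|/andP[_ /eqP->] //]; lia.
have /andP[i1n st'] := st.
pose P j := (i <= j < n)%N && monotone (factor w (i, j)).
have exP : exists j, P j.
  exists i; rewrite /P leqnn i_n /=; apply/monotone_factorP => [|k]; lia.
have ubP j : P j -> (j <= n)%N by case/andP; lia.
case: (ex_maxnP exP ubP) => j /andP[ij mj] jmax.
have i_lt_j : (i < j)%N.
  apply: jmax; rewrite /P leqnSn i1n /=; apply/monotone_factorP => [|k kij]; first lia.
  by congr asc; lia.
rewrite (@eq_in_count _ _ (pred1 j)) => [|k].
  by rewrite count_uniq_mem ?iota_uniq // mem_iota; congr nat_of_bool; lia.
rewrite mem_iota => ik; have ikn : (i <= k < n)%N by lia.
apply/(birunP ikn)/eqP => [[mk h]|->].
  have kj : (k <= j)%N by apply: jmax; rewrite /P ikn mk.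
  have kjn : (k <= j < n)%N by lia.
  by have [_ ->] := h i j (leqnn i) kjn mj.
split=> // i' j' i'i jj' mm; have [e|ne] := eqVneq i' i.
  split=> //; apply/eqP; rewrite eqn_leq; case/andP: (jj') => -> _; rewrite andbT.
  by apply: jmax; rewrite /P -e mm andbT; lia.
exfalso; move: st'; rewrite (_ : (i == 0)%N = false) /=; last lia.
move/monotone_factorP: mm => mm.
by rewrite !mm ?eqxx //; lia.
Qed.

Lemma count_birun : (1 < n)%N ->
  count (is_birun w) (factors w) = (\sum_(i < n) birun_start i)%N.
Proof.
move=> n1; rewrite -sum1_count big_mkcond big_allpairs_dep.
have -> : iota 0 (size w) = index_iota 0 n by rewrite /index_iota subn0.
rewrite big_mkord; apply: eq_bigr => i _.
by rewrite -count_birun_from // -sum1_count [RHS]big_mkcond.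
Qed.

(** In a word of length at least 2 no birun is a single letter, so that the additional
   up-down run at (0, 0) is not counted twice. *)
Lemma udr_birun_start : (1 < n)%N ->
  udr w = (\sum_(i < n) birun_start i + is_descent w 0)%N.
Proof.
move=> n1; rewrite -count_birun //.
pose single := predI (pred1 (0, 0)%N) (fun=> is_descent w 0).
have -> : nat_of_bool (is_descent w 0) = count single (factors w).
  rewrite /single; case: (is_descent w 0).
    rewrite (@eq_count _ _ (pred1 (0, 0)%N)) => [|p]; last by rewrite /= andbT.
    by rewrite count_uniq_mem ?factors_uniq // mem_factors /= (ltnW n1).
  by rewrite (@eq_count _ _ pred0) ?count_pred0 // => p; rewrite /= andbF.
rewrite -count_predUI (@eq_count _ (predI _ _) pred0) ?count_pred0 ?addn0 // => p.
apply/negP => /andP[/= + /andP[/eqP pE _]]; rewrite pE => /birunP[|_ h]; first lia.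
have n0 : (0 <= 1 < n)%N by lia.
have [||_ //] := h 0%N 1%N (leqnn 0); first by lia.
by apply/monotone_factorP => // -[|k].
Qed.

End Biruns.

Lemma count_id_pairmap_addb b s :
  count id (pairmap addb b s) =
  (\sum_(i < size s) (nth false (b :: s) i != nth false s i))%N.
Proof.
rewrite -sum1_count big_mkcond (big_nth false) big_mkord size_pairmap.
apply: eq_bigr => i _; rewrite (nth_pairmap false) //.
by move: (nth _ (b :: s) i) (nth _ s i) => [] [].
Qed.

(** The conventional ascent in front of x accounts for the up-down run consisting
   of the first letter alone. *)
Lemma udr_turns x w : uniq (x :: w) -> udr (x :: w) = (turns true x w).+1.
Proof.
move=> uw; case: w uw => [|y w] uw.
  by [].
rewrite udr_birun_start // big_ord_recl big_ord_recr /=.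
rewrite (_ : birun_start (x :: y :: w) (bump _ _) = false); last first.
  by rewrite /birun_start /bump /= ltnn.
rewrite addn0 /turns /= count_id_pairmap_addb size_pairmap.
rewrite add1n addSn addnC -ltnNge; congr (_ + _).+1.
apply: eq_bigr => i _; rewrite -[_ :: pairmap leq y w]/(pairmap leq x (y :: w)).
rewrite !(nth_pairmap 0%N) //=; last by rewrite ltnW // ltnS.
by rewrite /birun_start /bump /= !ltnS ltn_ord.
Qed.

(** * Eulerian polynomials *)

Lemma unique_sorting_perm m (r : rel 'I_m) :
  transitive r -> antisymmetric r -> total r ->
  (\sum_(pi : 'S_m) sorted r [seq pi i | i : 'I_m] = 1)%N.
Proof.
move=> r_tr r_anti r_tot; pose s := sort r (enum 'I_m).
have szs : size s = m by rewrite size_sort size_enum_ord.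
have us : uniq s by rewrite sort_uniq enum_uniq.
have inj : injective (tnth (Tuple (introT eqP szs))).
  by move=> i j; rewrite !(tnth_nth i) => /eqP; rewrite /= nth_uniq ?szs // => /eqP/val_inj.
have sE (pi : 'S_m) : sorted r [seq pi i | i : 'I_m] = (pi == perm inj).
  have permE' (sg : 'S_m) : perm_eq [seq sg i | i : 'I_m] (enum 'I_m).
    apply: uniq_perm => [||i]; last 1 first.
    - rewrite mem_enum; apply/mapP; exists ((sg^-1)%g i); last by rewrite permKV.
      by rewrite mem_enum.
    - by rewrite map_inj_uniq ?enum_uniq //; apply: perm_inj.
    exact: enum_uniq.
  apply/idP/eqP => [spi|->].
    have e : [seq pi i | i : 'I_m] = s.
      apply: (sorted_eq r_tr r_anti) => //; first exact: sort_sorted.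
      by rewrite (permPl (permE' pi)) perm_sym (permEl (perm_sort r _)).
    apply/permP => i; rewrite permE (tnth_nth i) /= -e (nth_map i) ?size_enum_ord //.
    by rewrite nth_ord_enum.
  rewrite (_ : [seq _ | i : 'I_m] = s) ?sort_sorted //.
  by rewrite /image_mem (eq_map (permE inj)) map_tnth_enum.
by under eq_bigr do rewrite sE; rewrite -big_mkcond big_pred1_eq.
Qed.

Lemma sum_wseqs_ffun r m (P : pred (seq nat)) :
  (forall s, P s -> sorted leq s) ->
  \sum_(s <- wseqs 0 r m) (P s)%:R =
  \sum_(f : {ffun 'I_m -> 'I_r}) (P [seq val (f i) | i : 'I_m])%:R :> rat.
Proof.
move=> P_sorted.
have -> : \sum_(f : {ffun 'I_m -> 'I_r}) (P [seq val (f i) | i : 'I_m])%:R =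
    \sum_(s <- [seq [seq val (f i) | i : 'I_m] | f : {ffun 'I_m -> 'I_r}]) (P s)%:R :> rat.
  by rewrite big_image.
have natrE (s : seq nat) : (P s)%:R = if P s then 1 else 0 :> rat by case: (P s).
under eq_bigr do rewrite natrE; under [RHS]eq_bigr do rewrite natrE.
rewrite -!big_mkcond -big_filter -[RHS]big_filter; apply/perm_big/uniq_perm.
- by rewrite filter_uniq ?wseqs_uniq.
- rewrite filter_uniq // map_inj_uniq ?enum_uniq // => f g /eq_in_map fg.
  by apply/ffunP => i; apply/val_inj/fg; rewrite mem_enum.
move=> s; rewrite !mem_filter mem_wseqs; case: (boolP (P s)) => //= /P_sorted ->.
apply/andP/mapP => [[/eqP szs /allP s_r]|[f _ ->]].
  have lt_r (i : 'I_m) : (nth 0%N s i < r)%N.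
    by have /= := s_r (nth 0%N s i); apply; rewrite mem_nth // szs.
  exists [ffun i => Ordinal (lt_r i)]; first by rewrite mem_enum.
  apply: (@eq_from_nth _ 0%N) => [|i]; rewrite ?size_image ?card_ord // szs => im.
  rewrite (nth_map (Ordinal im)) ?size_enum_ord // ffunE /=.
  by rewrite -[i in RHS]/(val (Ordinal im)) nth_ord_enum.
rewrite size_image card_ord; split=> //.
by apply/allP => _ /mapP[i _ ->] /=.
Qed.

(** Standardization: a map f from [m] to [k] is sorted by exactly one permutation
   if ties are broken by position, and then the sorted values are compatible with
   this permutation. *)
Lemma sum_perm_fillings m k :
  \sum_(pi : 'S_m) fillings (nseq k (true, 1)) (word pi) = (k ^ m)%:R.
Proof.
transitivity (\sum_(pi : 'S_m) \sum_(f : {ffun 'I_m -> 'I_k})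
    (compatible (word pi) [seq val (f (pi i)) | i : 'I_m])%:R : rat).
  apply: eq_bigr => pi _.
  have -> : nseq k (true, 1) = [seq (true, (fun=> 1) i) | i <- iota 0 k] :> seq letter.
    by rewrite -[k in LHS](size_iota 0 k); elim: (iota 0 k) => //= i s ->.
  rewrite -sum_compatible size_word.
  under eq_bigr do rewrite big1 ?mulr1 //.
  rewrite sum_wseqs_ffun => [|s /and3P[] //].
  rewrite (reindex_onto (fun f : {ffun 'I_m -> 'I_k} => [ffun i => f (pi i)])
    (fun f : {ffun 'I_m -> 'I_k} => [ffun i => f ((pi^-1)%g i)])) /=; last first.
    by move=> f _; apply/ffunP => i; rewrite !ffunE permK.
  apply: eq_big => [f|f _]; first by apply/eqP/ffunP => i; rewrite !ffunE permKV.
  by congr (compatible _ _)%:R; apply: eq_map => i; rewrite ffunE.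
rewrite exchange_big /=.
transitivity (\sum_(f : {ffun 'I_m -> 'I_k}) 1 : rat); last first.
  by rewrite sumr_const card_ffun !card_ord.
apply: eq_bigr => f _.
(* Compatibility of the values of f o pi says that pi sorts the indices by [key]. *)
pose key (i : 'I_m) := (val (f i), (val i).+1).
have key_inj : injective key by move=> i j [_ /val_inj].
rewrite -[RHS]/(1%:R) -(@unique_sorting_perm m (relpre key lexle)).
- rewrite natr_sum; apply: eq_bigr => pi _; congr (nat_of_bool _)%:R.
  rewrite compatibleE size_word size_image card_ord eqxx /= zip_map.
  by rewrite -sorted_map /image_mem -[in RHS]map_comp.
- by move=> i j l; apply: lexle_trans.
- by move=> i j /lexle_anti/key_inj.
- by move=> i j; apply: lexle_total.
Qed.

Definition powers (m : nat) : series nat := fun k => (k ^ m)%:R.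

Lemma eulerianE m : (0 < m)%N ->
  horner_alg 't (eulerian m) / (1 - 't) ^+ m.+1 = powers m.
Proof.
move=> m0.
have -> : powers m = \sum_(pi : 'S_m) filling_gf id true (word pi).
  apply/seriesP => k; rewrite coef_series_sum /powers -sum_perm_fillings.
  apply: eq_bigr => pi _; rewrite /filling_gf; congr (fillings _ _).
  by elim: k => //= k ->.
have u : (1 - 't) ^+ m.+1 \is a GRing.unit.
  by rewrite unitrX // fps_unitE coef_seriesD coef_seriesN coef_series1 subr0 oner_eq0.
rewrite /eulerian m0 raddf_sum /= mulr_suml; apply: eq_bigr => pi _.
apply: (canLR (mulrK u)); rewrite rmorphXn /= horner_algX mulrC.
case: (word pi) (size_word pi) => [|x w] szw; first by rewrite -szw in m0.
by rewrite -filling_gf_des -szw.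
Qed.

(** * Series in the square of the variable *)

(** The substitution t |-> t^2. *)
Definition dilate (f : series nat) : series nat :=
  fun r => if odd r then 0 else f r./2.

Lemma fps_sum_even u : fps_sum u (fun k => 2 * k)%N = dilate u.
Proof.
apply/seriesP => r; rewrite /fps_sum /dilate; case: ifP => r_odd.
  by apply: big1 => i /eqP; move: r_odd; lia.
have r2 : (r./2 < r.+1)%N by lia.
rewrite (big_pred1 (Ordinal r2)) // => i /=.
by rewrite -val_eqE /=; move: r_odd; lia.
Qed.

Lemma fps_sum_odd u : fps_sum u (fun k => 2 * k + 1)%N = 't * dilate u.
Proof.
apply/seriesP => -[|r]; rewrite coef_fpsTM /fps_sum /dilate.
  by apply: big1 => i /eqP; lia.
case: ifP => r_odd; first by apply: big1 => i /eqP; move: r_odd; lia.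
have r2 : (r./2 < r.+2)%N by lia.
rewrite (big_pred1 (Ordinal r2)) // => i /=.
by rewrite -val_eqE /=; move: r_odd; lia.
Qed.

Lemma dilate_sum I (s : seq I) (P : pred I) (k : I -> rat) (F : I -> series nat) :
  dilate (\sum_(i <- s | P i) k i *: F i) = \sum_(i <- s | P i) k i *: dilate (F i).
Proof.
apply/seriesP => r; rewrite [RHS]coef_series_sum [LHS]/dilate.
case: ifP => r_odd; last rewrite coef_series_sum.
  by rewrite big1 // => i _; rewrite coef_seriesZ /dilate r_odd mulr0.
by apply: eq_bigr => i _; rewrite !coef_seriesZ /dilate r_odd.
Qed.

Lemma sum_even_terms (F : nat -> rat) m : (forall i, odd i -> F i = 0) ->
  \sum_(i < m.*2.+1) F i = \sum_(i < m.+1) F i.*2.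
Proof.
move=> F0; elim: m => [|m IHm]; first by rewrite !big_ord1.
rewrite doubleS big_ord_recr big_ord_recr [RHS]big_ord_recr /= IHm.
by rewrite (F0 m.*2.+1) ?addr0 //= odd_double.
Qed.

Lemma dilateM f g : dilate (f * g) = dilate f * dilate g.
Proof.
apply/seriesP => r; rewrite coef_fpsM {1}/dilate.
case: ifP => r_odd.
  rewrite big1 // => i _; rewrite /dilate oddB ?leq_ord // r_odd.
  by case: (odd i); rewrite /= ?mul0r ?mulr0.
rewrite -(even_halfK (negbT r_odd)) doubleK; move: r./2 => k.
rewrite (sum_even_terms (F := fun i => dilate f i * dilate g (k.*2 - i)%N)); last first.
  by move=> i i_odd; rewrite /dilate i_odd mul0r.
rewrite coef_fpsM; apply: eq_bigr => i _.
by rewrite -doubleB /dilate !odd_double !doubleK.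
Qed.

Lemma dilate_poly p : dilate (horner_alg 't p) = horner_alg ('t ^+ 2) p.
Proof.
have dD f g : dilate (f + g) = dilate f + dilate g.
  by apply/seriesP => r; rewrite /dilate !coef_seriesD; case: ifP; rewrite ?addr0.
have dC (k : rat) : dilate (k%:A) = k%:A.
  apply/seriesP => r; rewrite /dilate !coef_seriesZ !coef_series1.
  by case: r => [|[|r]] //=; rewrite ?mulr0 ?if_same.
have dT : dilate 't = 't ^+ 2.
  apply/seriesP => r; rewrite expr2 coef_fpsTM /dilate.
  by case: r => [|[|[|[|r]]]] //=; rewrite /fpsT /= if_same.
elim/poly_ind: p => [|p k IHp].
  by rewrite !rmorph0; apply/seriesP => r; rewrite /dilate if_same.
by rewrite !rmorphD !rmorphM /= !horner_algX !horner_algC dD dilateM IHp dC dT.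
Qed.

Lemma dilate_quotient p m f : horner_alg 't p / (1 - 't) ^+ m = f ->
  horner_alg ('t ^+ 2) p / (1 - 't ^+ 2) ^+ m = dilate f.
Proof.
have u : (1 - 't ^+ 2) ^+ m \is a GRing.unit.
  by rewrite unitrX // fps_unitE coef_seriesD coef_seriesN expr2 coef_fpsTM
    coef_series1 subr0 oner_eq0.
have v : (1 - 't) ^+ m \is a GRing.unit.
  by rewrite unitrX // fps_unitE coef_seriesD coef_seriesN coef_series1 subr0 oner_eq0.
move=> <-; apply: (canLR (mulrK u)).
have polyE (x : series nat) : (1 - x) ^+ m = horner_alg x ((1 - 'X) ^+ m).
  by rewrite rmorphXn rmorphB rmorph1 /= horner_algX.
by rewrite (polyE ('t ^+ 2)) -!dilate_poly -dilateM -polyE divrK.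
Qed.

(** An identity of polynomials remains true under the linear map 'X^k |-> S k. *)
Lemma scaler_coef_transfer (I J : Type) (r : seq I) (s : seq J) (P : pred I) (R : pred J)
    (e : I -> nat) (a : I -> rat) (g : J -> nat) (b : J -> rat) n
    (V : lmodType rat) (S : nat -> V) :
  (forall i, P i -> e i <= n)%N -> (forall j, R j -> g j <= n)%N ->
  \sum_(i <- r | P i) a i *: 'X^(e i) = \sum_(j <- s | R j) b j *: 'X^(g j) :> {poly rat} ->
  \sum_(i <- r | P i) a i *: S (e i) = \sum_(j <- s | R j) b j *: S (g j).
Proof.
pose Phi (p : {poly rat}) := \sum_(k < n.+1) p`_k *: S k.
have PhiE K (t : seq K) (Q : pred K) (h : K -> nat) (k : K -> rat) :
    (forall i, Q i -> h i <= n)%N ->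
    Phi (\sum_(i <- t | Q i) k i *: 'X^(h i)) = \sum_(i <- t | Q i) k i *: S (h i).
  move=> hn; rewrite /Phi; under eq_bigr do rewrite coef_sum scaler_suml.
  rewrite exchange_big /=; apply: eq_bigr => i /hn; rewrite -ltnS => hi.
  rewrite (bigD1 (Ordinal hi)) //= coefZ coefXn eqxx mulr1 big1 ?addr0 // => j.
  by rewrite -val_eqE /= coefZ coefXn => /negbTE ->; rewrite mulr0 scale0r.
by move=> en gn /(congr1 Phi); rewrite !PhiE.
Qed.

(** * The two sides of the theorem *)

Lemma sub1_sign i : 1 - (-1) ^+ i = (odd i)%:R * 2%:R :> rat.
Proof.
by rewrite -signr_odd; case: (odd i); rewrite ?expr1 ?expr0 ?subrr ?opprK ?mul1r ?mul0r.
Qed.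

Lemma prod_odd_parts k s :
  \prod_(i <- s) (k%:R * (1 - (-1) ^+ i)) =
  if all odd s then 2%:R ^+ size s * (k ^ size s)%:R else 0 :> rat.
Proof.
elim: s => [|i s IHs] /=; first by rewrite big_nil expn0 mulr1.
rewrite big_cons IHs sub1_sign; case: (odd i) => /=; last by rewrite mul0r mulr0 mul0r.
by case: ifP => _; rewrite ?mulr0 // exprS expnS natrM; ring.
Qed.

Lemma prod_odd_parts1 k s :
  \prod_(i <- s) (k%:R * (1 - (-1) ^+ i) + 1) = (k.*2.+1 ^ count odd s)%:R :> rat.
Proof.
elim: s => [|i s IHs] /=; first by rewrite big_nil expn0.
rewrite big_cons IHs sub1_sign expnD natrM; congr (_ * _).
case: (odd i) => /=; last by rewrite mul0r mulr0 add0r.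
by rewrite expn1 -[k.*2.+1]addn1 natrD -muln2 natrM mul1r.
Qed.

Lemma letter_psum_alt i k :
  letter_psum i [seq (b, 1) | b <- traject negb true k.*2] = k%:R * (1 - (-1) ^+ i).
Proof.
elim: k => [|k IHk]; first by rewrite /letter_psum big_nil mul0r.
rewrite doubleS /letter_psum /= !big_cons -/(letter_psum i _) IHk /= expr1n.
by rewrite -natr1; ring.
Qed.

Lemma letter_psum_altS i k :
  letter_psum i [seq (b, 1) | b <- traject negb true k.*2.+1] =
  k%:R * (1 - (-1) ^+ i) + 1.
Proof.
rewrite trajectSr map_rcons -cats1 letter_psum_cat letter_psum_alt.
have -> : iter k.*2 negb true = true by elim: k => //= k ->.
by rewrite /letter_psum big_seq1 /= expr1n.
Qed.

(** [filling_gf_turns] solved for the generating function: since udr exceeds the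
   number of turns by one, a factor q = 2t/(1+t^2) absorbs the numerator t. *)
Lemma udr_term n (pi : 'S_n) : (0 < n)%N ->
  (1 + 't ^+ 2) ^+ n / (2%:R * (1 - 't) ^+ 2 * (1 - 't ^+ 2) ^+ (n - 1)) *
    (2%:R * 't / (1 + 't ^+ 2)) ^+ udr (word pi) = filling_gf negb true (word pi).
Proof.
move=> n0; have uw : uniq (word pi).
  by rewrite map_inj_uniq ?enum_uniq // => i j [/val_inj/perm_inj].
case: (word pi) (size_word pi) uw => [|x w] szw uw; first by rewrite -szw in n0.
rewrite -szw -[size (x :: w)]/(size w).+1 subSS subn0 udr_turns //.
set q := 2%:R * 't / _; set g := filling_gf _ _ _.
have uP : 1 + 't ^+ 2 \is a GRing.unit by have := fps_unit1Dt 1 1; rewrite mulr1.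
have uM : 1 - 't ^+ 2 \is a GRing.unit.
  by have := fps_unit1Dt (-1) 1; rewrite mulrN1.
have u1 : 1 - 't \is a GRing.unit.
  by have := fps_unit1Dt (-1) 0; rewrite expr1 mulrN1.
have u2 : 2%:R \is a @GRing.unit (series nat).
  by rewrite fps_unitE mulr2n coef_seriesD coef_series1.
have qE : (1 + 't ^+ 2) * q = 2%:R * 't by rewrite mulrC divrK.
have gE := filling_gf_turns true x w qE.
rewrite mulrAC; apply: (canLR (mulrK _)).
  by rewrite unitrM unitrX // andbT unitrM u2 unitrX.
transitivity ((1 + 't ^+ 2) * q * ((1 + 't ^+ 2) ^+ size w * q ^+ turns true x w)).
  by rewrite !exprS; ring.
rewrite qE; transitivity (2%:R * ('t * (1 + 't ^+ 2) ^+ size w * q ^+ turns true x w)).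
  by ring.
by rewrite -gE -/g; ring.
Qed.

Theorem theorem3p7 (n : nat) (n_ge1 : (1 <= n)%N) (Pi : {set 'S_n})
  (Q : symfun) (Q_def : symfun_val Q = Qgf Pi)
  (c : intpart n -> rat) (Q_psum : Q = psum_poly c psum)
  (a d : nat -> rat)
  (a_def : \sum_(1 <= k < n.+1) a k *: 'X^k =
           psum_poly c (fun i => if odd i then 'X else 0 : {poly rat}))
  (d_def : \sum_(0 <= k < n.+1) d k *: 'X^k =
           psum_poly c (fun i => if odd i then 'X else 1 : {poly rat})) :
  [/\ (1 + 't ^+ 2) ^+ n / (2%:R * (1 - 't) ^+ 2 * (1 - 't ^+ 2) ^+ (n - 1))
        * horner_alg (2%:R * 't / (1 + 't ^+ 2)) (Pudr Pi)
      = fps_sum (fun k => Theta1 k Q) (fun k => 2 * k)%N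
        + fps_sum (fun k => Theta1 k (plethysm_X1 Q)) (fun k => 2 * k + 1)%N,
      fps_sum (fun k => Theta1 k Q) (fun k => 2 * k)%N
        + fps_sum (fun k => Theta1 k (plethysm_X1 Q)) (fun k => 2 * k + 1)%N
      = \sum_(l : intpart n | all odd l) (c l * 2%:R ^+ size l) *:
            (horner_alg ('t ^+ 2) (eulerian (size l))
               / (1 - 't ^+ 2) ^+ (size l).+1)
        + 't * \sum_(l : intpart n) c l *:
            (horner_alg ('t ^+ 2) (eulerianB (count odd l))
               / (1 - 't ^+ 2) ^+ (count odd l).+1)
    & \sum_(l : intpart n | all odd l) (c l * 2%:R ^+ size l) *:
            (horner_alg ('t ^+ 2) (eulerian (size l))
               / (1 - 't ^+ 2) ^+ (size l).+1)
        + 't * \sum_(l : intpart n) c l *: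
            (horner_alg ('t ^+ 2) (eulerianB (count odd l))
               / (1 - 't ^+ 2) ^+ (count odd l).+1)
      = \sum_(1 <= k < n.+1) (a k * 2%:R ^+ k) *:
            (horner_alg ('t ^+ 2) (eulerian k) / (1 - 't ^+ 2) ^+ k.+1)
        + 't * \sum_(0 <= k < n.+1) d k *:
            (horner_alg ('t ^+ 2) (eulerianB k) / (1 - 't ^+ 2) ^+ k.+1)].
Proof.
have powersE (k : nat) : Theta1 k Q = (\sum_(l : intpart n | all odd l)
    (c l * 2%:R ^+ size l) *: powers (size l)) k.
  rewrite Q_psum Theta1_psum_poly coef_series_sum [RHS]big_mkcond.
  apply: eq_bigr => l _; rewrite prod_odd_parts coef_seriesZ /powers.
  by case: ifP => _; rewrite ?mulr0 // mulrA.
have odd_powersE (k : nat) : Theta1 k (plethysm_X1 Q) = (\sum_(l : intpart n)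
    c l *: odd_powers (count odd l)) k.
  rewrite Q_psum Theta1_plethysm_X1 coef_series_sum.
  by apply: eq_bigr => l _; rewrite prod_odd_parts1 coef_seriesZ coef_odd_powers.
rewrite fps_sum_even fps_sum_odd.
split.
- have QE : symfun_val (psum_poly c psum) = Qgf Pi by rewrite -Q_psum.
  transitivity (\sum_(pi in Pi) filling_gf negb true (word pi)).
    rewrite /Pudr raddf_sum mulr_sumr; apply: eq_bigr => pi _.
    by rewrite -udr_term //= rmorphXn /= horner_algX.
  apply/seriesP => r; rewrite coef_series_sum coef_seriesD coef_fpsTM.
  (* The r alternating letters specialize p_i to k (1 - (-1)^i), plus 1 for odd r. *)
  rewrite (sum_fillings QE) -(odd_double_half r) Q_psum.
  move: (r./2) => k; case: (odd r); rewrite ?add1n ?add0n.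
    under eq_bigr do under eq_bigr do rewrite letter_psum_altS.
    by rewrite /dilate /= odd_double doubleK add0r Theta1_plethysm_X1.
  under eq_bigr do under eq_bigr do rewrite letter_psum_alt.
  rewrite -Theta1_psum_poly [dilate _ _]/dilate odd_double doubleK.
  by case: k => [|k]; rewrite ?addr0 // doubleS /dilate /= odd_double addr0.
- congr (_ + 't * _).
    rewrite (_ : (fun k : nat => Theta1 k Q) = \sum_(l : intpart n | all odd l)
      (c l * 2%:R ^+ size l) *: powers (size l)); last by apply/funext.
    rewrite dilate_sum; apply: eq_bigr => l l_odd; congr (_ *: _).
    exact/esym/dilate_quotient/eulerianE/size_parts_gt0.
  rewrite (_ : (fun k : nat => Theta1 k (plethysm_X1 Q)) = \sum_(l : intpart n)
    c l *: odd_powers (count odd l)); last by apply/funext.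
  rewrite dilate_sum; apply: eq_bigr => l l_odd; congr (_ *: _).
  exact/esym/dilate_quotient/eulerianBE.
have prod_odd (x : {poly rat}) (l : intpart n) :
    \prod_(i <- parts l) (if odd i then 'X else x) =
      'X^(count odd l) * x ^+ count (predC odd) l.
  elim: (parts l) => [|i t IHt]; first by rewrite big_nil !expr0 mulr1.
  by rewrite big_cons IHt /=; case: (odd i); rewrite add1n add0n exprS; ring.
congr (_ + 't * _).
- pose S k := 2%:R ^+ k *: (horner_alg ('t ^+ 2) (eulerian k) / (1 - 't ^+ 2) ^+ k.+1).
  under eq_bigr do rewrite -scalerA -/(S _).
  under [RHS]eq_bigr do rewrite -scalerA -/(S _).
  rewrite [RHS]big_seq; apply: (@scaler_coef_transfer _ _ _ _ _ _ _ _ _ _ n) => [l _|k|].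
  + exact: size_parts.
  + by rewrite mem_index_iota => /andP[].
  rewrite -big_seq a_def [LHS]big_mkcond; apply: eq_bigr => l _.
  rewrite prod_odd expr0n -leqn0 leqNgt -has_count has_predC negbK.
  by case: ifP => [|_]; rewrite ?mulr0 ?scaler0 // mulr1 all_count => /eqP ->.
pose S k := horner_alg ('t ^+ 2) (eulerianB k) / (1 - 't ^+ 2) ^+ k.+1.
rewrite -/(S _) [RHS]big_seq; apply: (@scaler_coef_transfer _ _ _ _ _ _ _ _ _ _ n _ S) => [l _|k|].
- exact: leq_trans (count_size _ _) (size_parts l).
- by rewrite mem_index_iota.
rewrite -big_seq d_def; apply: eq_bigr => l _.
by rewrite prod_odd expr1n mulr1.
Qed.
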